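(* Let $\mathcal{V}$ be a variety and let $p$ be a term in the language $\{\circ,\wedge,\vee\}$ in three variables. Suppose that $\alpha\wedge(\beta\circ\gamma)\leq p(\alpha,\beta,\gamma)$ is a congruence equation that fails on a $3$-element set for some congruences with pairwise trivial intersection, i.e. there are equivalence relations $\alpha_0,\beta_0,\gamma_0$ on a $3$-element set, any two of which intersect in the equality relation, such that $\alpha_0\wedge(\beta_0\circ\gamma_0)\not\leq p(\alpha_0,\beta_0,\gamma_0)$. Then the following are equivalent: (1) the abelian algebras of the idempotent reduct of $\mathcal{V}$ satisfy $\alpha\wedge(\beta\circ\gamma)\leq p(\alpha,\beta,\gamma)$; (2) $\mathcal{V}$ satisfies the commutator equations $\mathrm{Eq}_{C}(\alpha\wedge(\beta\circ\gamma)\leq p^{(k)}(\alpha,\beta,\gamma))$ for some $k>2$; (3) $\mathcal{V}$ satisfies the equations $$\alpha\wedge(\beta\circ\gamma)\leq p(\alpha',\beta',\gamma'),$$ where $\alpha'=\alpha\circ G(\alpha,\beta,\gamma)\circ\alpha$, $\beta'=\beta\circ G(\beta,\alpha,\gamma)\circ\beta$, $\gamma'=\gamma\circ G(\gamma,\alpha,\beta)\circ\gamma$, with $$G(\alpha,\beta,\gamma)\in\{[\beta\wedge(\alpha\vee\gamma),\beta\wedge(\alpha\vee\gamma)],\ [\gamma\wedge(\alpha\vee\beta),\gamma\wedge(\alpha\vee\beta)]\}$$ (and correspondingly for $G(\beta,\alpha,\gamma)$ and $G(\gamma,\alpha,\beta)$, permuting the arguments), for all such choices; (4) there exists $n\in\mathbb{N}$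 such that $\mathcal{V}$ satisfies the equations $$\alpha\wedge(\beta\circ\gamma)\leq p(\alpha',\beta',\gamma'),$$ where $\alpha'=\alpha\circ F(\alpha,\beta,\gamma)\circ\alpha$, $\beta'=\beta\circ F(\beta,\alpha,\gamma)\circ\beta$, $\gamma'=\gamma\circ F(\gamma,\beta,\alpha)\circ\gamma$, with $$F(\alpha,\beta,\gamma)\in\{\beta\wedge y^n(\beta,\alpha,\gamma),\ \beta\wedge y^n(\beta,\gamma,\alpha),\ \gamma\wedge y^n(\gamma,\beta,\alpha),\ \gamma\wedge y^n(\gamma,\alpha,\beta)\}$$ (and correspondingly for $F(\beta,\alpha,\gamma)$ and $F(\gamma,\beta,\alpha)$, permuting the arguments), for all such choices.
   Context: Commutator. For an algebra $\mathbf{A}$ and $\alpha,\beta,\delta\in\operatorname{Con}(\mathbf{A})$, write $C(\alpha,\beta;\delta)$ if for all $n,m$, all polynomial operations $f\in\operatorname{Pol}_{n+m}(\mathbf{A})$, all $\mathbf{a}\equiv_\alpha\mathbf{b}$ in $A^n$ and $\mathbf{u}\equiv_\beta\mathbf{v}$ in $A^m$ (componentwise): if $f(\mathbf{a},\mathbf{u})\equiv_\delta f(\mathbf{a},\mathbf{v})$ then $f(\mathbf{b},\mathbf{u})\equiv_\delta f(\mathbf{b},\mathbf{v})$. The commutator $[\alpha,\beta]$ is the smallest $\delta\in\operatorname{Con}(\mathbf{A})$ with $C(\alpha,\beta;\delta)$. An algebra is abelian if $[1,1]=0$ for its largest congruence $1$ and smallest congruence $0$. Commutator equations. For $n$-ary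 terms $u,v$, an algebra $\mathbf{A}$ satisfies $u\approx_C v$ if for all $\theta\in\operatorname{Con}(\mathbf{A})$ and all $a_1,\dots,a_n\in A$ in the same $\theta$-class, $(u^{\mathbf{A}}(a_1,\dots,a_n),v^{\mathbf{A}}(a_1,\dots,a_n))\in[\theta,\theta]$. A variety satisfies it if all its algebras do. Idempotent reduct. A term $t$ is idempotent in $\mathcal{V}$ if $\mathcal{V}\models t(x,\dots,x)\approx x$. The idempotent reduct of an algebra $\mathbf{A}\in\mathcal{V}$ is the algebra on $A$ whose basic operations are the interpretations of all idempotent terms of $\mathcal{V}$; the idempotent reduct of $\mathcal{V}$ is the variety generated by the idempotent reducts of the algebras of $\mathcal{V}$. Congruence equations. The variables $\alpha,\beta,\gamma$ range over all congruences of an arbitrary algebra of the class considered; $\leq$ is inclusion of binary relations, $\wedge$ is intersection, $\circ$ is relational composition. For reflexive relations $R,S$, $R\vee S$ is the union over $k$ of the $k$-fold alternating products $R\circ S\circ R\circ\cdots$ ($k$ factors), i.e. the transitive closure of $R\cup S$; for congruences this is the join in the congruence lattice. For a $\{\circ,\wedge,\vee\}$-term $p$ and $k\in\mathbb{N}$, $p^{(k)}$ is the $\{\circ,\wedge\}$-term obtained by replacing every occurrence $r\vee s$ of a join by the $k$-fold product $r\circ s\circ r\circ\cdots$ ($k$ factors). Herringbone terms. $y^{0}(x,y,z)=y$ and $y^{n+1}(x,y,z)=y\vee(x\wedge y^{n}(x,z,y))$ for $n\in\mathbb{N}$. Labelled graph $\mathbf{G}(r)$ of a $\{\wedge,\circ\}$-term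 $r$ in variables $X_1,\dots,X_m$. Start with two vertices $x_1,x_2$ and one directed edge $(x_1,x_2)$ labelled $r$. While some edge $(x_i,x_j)$ has a label that is not a variable: if the label is $u\wedge v$, replace the edge by two edges $(x_i,x_j)$ labelled $u$ and $v$; if the label is $u\circ v$, add a new vertex $x_{k+1}$ (where $x_1,\dots,x_k$ are the current vertices) and replace the edge by $(x_i,x_{k+1})$ labelled $u$ and $(x_{k+1},x_j)$ labelled $v$. The final graph, all of whose labels are variables, is $\mathbf{G}(r)$ (unique up to reordering of vertices). The set $\mathrm{Eq}_C(r\leq q)$ for $\{\wedge,\circ\}$-terms $r,q$ in $X_1,\dots,X_m$. Let $x_1,\dots,x_n$ be the vertices of $\mathbf{G}(r)$, and to each vertex $x_i$ of $\mathbf{G}(q)$ associate an $n$-ary term $t_i$ in the variables $x_1,\dots,x_n$, where $t_1=x_1$ and $t_2=x_2$ and the other $t_i$ are unspecified. For $1\leq s\leq m$ let $T_s(r)$ be the set of pairs $(x_i,x_j)$ that are edges of $\mathbf{G}(r)$ labelled $X_s$, and let $\sigma_s$ be a transversal of the equivalence relation on $\{x_1,\dots,x_n\}$ generated by $T_s(r)$, i.e. a map sending all variables of a class to one fixed element of that class. Then $\mathrm{Eq}_C(r\leq q)$ consists of all commutator equations $$t_i(\sigma_s(x_1),\dots,\sigma_s(x_n))\approx_C t_j(\sigma_s(x_1),\dots,\sigma_s(x_n))$$ for $1\leq s\leq m$ and $(x_i,x_j)$ an edge of $\mathbf{G}(q)$ labelled $X_s$. A variety satisfies $\mathrm{Eq}_C(r\leq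 q)$ if the unspecified $t_i$ can be chosen as terms of the variety so that all these commutator equations hold. *)

(* Defs.v *)
From Stdlib Require Import Relations.
From mathcomp Require Import all_boot.

Set Implicit Arguments.
Unset Strict Implicit.
Unset Printing Implicit Defensive.

Record signature := Signature {
  op : Type;
  arity : op -> nat
}.

Record algebra (S : signature) := Algebra {
  carrier :> Type;
  interp : forall f : op S, ('I_(arity f) -> carrier) -> carrier;
  carrier_inhabited : inhabited carrier
}.

Inductive term (S : signature) (X : Type) : Type :=
| Var of X
| App (f : op S) of ('I_(arity f) -> term S X).

Arguments Var {S X} _.
Arguments App {S X} f _.

Fixpoint eval (S : signature) (A : algebra S) (X : Type) (e : X -> A)
    (t : term S X) : A :=
  match t with
  | Var x => e x
  | App f ts => interp (fun i => eval e (ts i))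
  end.

Fixpoint rename (S : signature) (X Y : Type) (s : X -> Y)
    (t : term S X) : term S Y :=
  match t with
  | Var x => Var (s x)
  | App f ts => App f (fun i => rename s (ts i))
  end.

Definition models (S : signature) (E : term S nat -> term S nat -> Prop)
    (A : algebra S) : Prop :=
  forall s t, E s t -> forall e : nat -> A, eval e s = eval e t.

Definition is_variety (S : signature) (V : algebra S -> Prop) : Prop :=
  exists E : term S nat -> term S nat -> Prop, forall A, V A <-> models E A.

Definition generated_variety (S : signature) (K : algebra S -> Prop)
    (A : algebra S) : Prop :=
  forall W : algebra S -> Prop,
    is_variety W -> (forall B, K B -> W B) -> W A.

Definition idempotent_in (S : signature) (V : algebra S -> Prop) (n : nat)
    (t : term S 'I_n) : Prop :=
  forall A : algebra S, V A -> forall x : A, eval (fun=> x) t = x.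

Definition idem_sig (S : signature) (V : algebra S -> Prop) : signature :=
  @Signature {n : nat & {t : term S 'I_n | idempotent_in V t}}
             (fun f => projT1 f).

Definition idem_reduct_alg (S : signature) (V : algebra S -> Prop)
    (A : algebra S) : algebra (idem_sig V) :=
  @Algebra (idem_sig V) A
    (fun f (a : 'I_(projT1 f) -> A) => eval a (sval (projT2 f)))
    (carrier_inhabited A).

Definition idem_reduct (S : signature) (V : algebra S -> Prop) :
    algebra (idem_sig V) -> Prop :=
  generated_variety
    (fun B => exists2 A : algebra S, V A & B = idem_reduct_alg V A).

Definition rle (T : Type) (R Q : relation T) : Prop :=
  forall x y, R x y -> Q x y.

Definition rmeet (T : Type) (R Q : relation T) : relation T :=
  fun x y => R x y /\ Q x y.

Definition rcomp (T : Type) (R Q : relation T) : relation T :=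
  fun x y => exists2 z, R x z & Q z y.

(** [alt o k r s] is [r o s o r o ...] with [k] factors, for [k >= 1];
    the value [r] at [k = 0] is a junk value. *)
Fixpoint alt (T : Type) (o : T -> T -> T) (k : nat) (r s : T) : T :=
  match k with
  | 0 => r
  | k'.+1 => if k' is 0 then r else o r (alt o k' s r)
  end.

(** Only meaningful for reflexive relations, as are all its uses here. *)
Definition rjoin (T : Type) (R Q : relation T) : relation T :=
  fun x y => exists k, alt (@rcomp T) k R Q x y.

Definition congruence (S : signature) (A : algebra S) (R : relation A) : Prop :=
  equivalence A R /\
  forall (f : op S) (a b : 'I_(arity f) -> A),
    (forall i, R (a i) (b i)) -> R (interp a) (interp b).

(** Polynomial operations: terms whose leaves are variables or elements of
    the algebra; the [n + m] variables are split into two blocks. *)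
Definition peval (S : signature) (A : algebra S) (n m : nat)
    (f : term S ('I_n + 'I_m + A)) (a : 'I_n -> A) (u : 'I_m -> A) : A :=
  eval (fun x => match x with
                 | inl (inl i) => a i
                 | inl (inr j) => u j
                 | inr c => c
                 end) f.

Definition centralizes (S : signature) (A : algebra S)
    (alpha beta delta : relation A) : Prop :=
  forall (n m : nat) (f : term S ('I_n + 'I_m + A))
         (a b : 'I_n -> A) (u v : 'I_m -> A),
    (forall i, alpha (a i) (b i)) -> (forall j, beta (u j) (v j)) ->
    delta (peval f a u) (peval f a v) -> delta (peval f b u) (peval f b v).

(** The smallest congruence [delta] with [centralizes alpha beta delta], see
    [commP]. *)
Definition comm (S : signature) (A : algebra S) (alpha beta : relation A) :
    relation A :=
  fun x y => forall delta : relation A,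
    congruence delta -> centralizes alpha beta delta -> delta x y.

Lemma commP (S : signature) (A : algebra S) (alpha beta : relation A) :
  [/\ congruence (comm alpha beta),
      centralizes alpha beta (comm alpha beta) &
      forall delta : relation A, congruence delta ->
        centralizes alpha beta delta -> rle (comm alpha beta) delta].
Proof.
split.
- split; first split.
  + by move=> x d [[r _ _] _] _; apply: r.
  + move=> x y z xy yz d cd zd; case: (cd) => -[_ tr _] _.
    exact: tr (xy d cd zd) (yz d cd zd).
  + move=> x y xy d cd zd; case: (cd) => -[_ _ sy] _.
    exact: sy (xy d cd zd).
  + move=> f a b ab d cd zd; case: (cd) => _; apply=> i.
    exact: ab i d cd zd.
- move=> n m f a b u v ab uv h d cd zd.
  exact: zd ab uv (h d cd zd).
- by move=> d cd zd x y; apply.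
Qed.

Definition abelian (S : signature) (A : algebra S) : Prop :=
  forall x y : A,
    comm (fun _ _ : A => True) (fun _ _ : A => True) x y <-> x = y.

Definition satisfies_ceq (S : signature) (V : algebra S -> Prop) (n : nat)
    (u v : term S 'I_n) : Prop :=
  forall A : algebra S, V A ->
  forall theta : relation A, congruence theta ->
  forall a : 'I_n -> A, (forall i j, theta (a i) (a j)) ->
    comm theta theta (eval a u) (eval a v).

Inductive jterm (m : nat) : Type :=
| JVar of 'I_m
| JComp of jterm m & jterm m
| JMeet of jterm m & jterm m
| JJoin of jterm m & jterm m.

Inductive cterm (m : nat) : Type :=
| CVar of 'I_m
| CComp of cterm m & cterm m
| CMeet of cterm m & cterm m.

Fixpoint jval (m : nat) (T : Type) (e : 'I_m -> relation T) (p : jterm m) :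
    relation T :=
  match p with
  | JVar s => e s
  | JComp q r => rcomp (jval e q) (jval e r)
  | JMeet q r => rmeet (jval e q) (jval e r)
  | JJoin q r => rjoin (jval e q) (jval e r)
  end.

Definition jval3 (T : Type) (p : jterm 3) (alpha beta gamma : relation T) :
    relation T :=
  jval (tnth [tuple alpha; beta; gamma]) p.

(** [unjoin k p] is p^(k): joins become [k]-fold alternating products. *)
Fixpoint unjoin (k m : nat) (p : jterm m) : cterm m :=
  match p with
  | JVar s => CVar s
  | JComp q r => CComp (unjoin k q) (unjoin k r)
  | JMeet q r => CMeet (unjoin k q) (unjoin k r)
  | JJoin q r => alt (@CComp m) k (unjoin k q) (unjoin k r)
  end.

Fixpoint herringbone (T : Type) (n : nat) (x y z : relation T) : relation T :=
  match n with
  | 0 => y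
  | n'.+1 => rjoin y (rmeet x (herringbone n' x z y))
  end.

(** Vertices are numbered from 0, so [0] and [1] are the two initial vertices.
    [expand r i j k] decomposes an edge [(i, j)] labelled [r] when [k] vertices
    have been added to the two initial ones; it returns the new number of added
    vertices and the resulting edges. *)
Fixpoint expand (m : nat) (r : cterm m) (i j k : nat) :
    nat * seq (nat * nat * 'I_m) :=
  match r with
  | CVar s => (k, [:: (i, j, s)])
  | CMeet u v =>
      let: (k1, E1) := expand u i j k in
      let: (k2, E2) := expand v i j k1 in
      (k2, E1 ++ E2)
  | CComp u v =>
      let: (k1, E1) := expand u i k.+2 k.+1 in
      let: (k2, E2) := expand v k.+2 j k1 in
      (k2, E1 ++ E2)
  end.

Definition nvert (m : nat) (r : cterm m) : nat := (expand r 0 1 0).1.+2.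

Definition edges (m : nat) (r : cterm m) : seq (nat * nat * 'I_m) :=
  (expand r 0 1 0).2.

Lemma expand_bound (m : nat) (r : cterm m) (i j k : nat) :
  i < k.+2 -> j < k.+2 ->
  k <= (expand r i j k).1 /\
  all (fun e => (e.1.1 < (expand r i j k).1.+2) &&
                (e.1.2 < (expand r i j k).1.+2)) (expand r i j k).2.
Proof.
elim: r i j k => [s|u IHu v IHv|u IHu v IHv] i j k ik jk /=.
- by rewrite ik jk.
- have := IHu i k.+2 k.+1 (ltnW ik) (ltnSn _).
  case: (expand u _ _ _) => k1 E1 /= [k1k b1].
  have jk1 : j < k1.+2 by rewrite (leq_trans jk) // !ltnS ltnW.
  have := IHv k.+2 j k1 k1k jk1.
  case: (expand v _ _ _) => k2 E2 /= [k21 b2].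
  split; first exact: leq_trans (ltnW k1k) k21.
  rewrite all_cat b2 andbT; apply: sub_all b1 => e /andP[h1 h2].
  by rewrite (leq_trans h1) ?(leq_trans h2).
- have := IHu i j k ik jk.
  case: (expand u _ _ _) => k1 E1 /= [k1k b1].
  have ik1 : i < k1.+2 by rewrite (leq_trans ik).
  have jk1 : j < k1.+2 by rewrite (leq_trans jk).
  have := IHv i j k1 ik1 jk1.
  case: (expand v _ _ _) => k2 E2 /= [k21 b2].
  split; first exact: leq_trans k1k k21.
  rewrite all_cat b2 andbT; apply: sub_all b1 => e /andP[h1 h2].
  by rewrite (leq_trans h1) ?(leq_trans h2).
Qed.

(** Hence no edge is lost by restricting to vertices in ['I_(nvert r)]. *)
Lemma edges_bound (m : nat) (r : cterm m) :
  all (fun e => (e.1.1 < nvert r) && (e.1.2 < nvert r)) (edges r).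
Proof. exact: (expand_bound r (i := 0) (j := 1) (k := 0) isT isT).2. Qed.

Definition edge (m : nat) (r : cterm m) (s : 'I_m) (i j : 'I_(nvert r)) : Prop :=
  (val i, val j, s) \in edges r.

Definition vert1 (m : nat) (r : cterm m) : 'I_(nvert r) :=
  @Ordinal (nvert r) 0 isT.

Definition vert2 (m : nat) (r : cterm m) : 'I_(nvert r) :=
  @Ordinal (nvert r) 1 isT.

Definition transversal_of (T : Type) (E : relation T) (sigma : T -> T) : Prop :=
  (forall x, clos_refl_sym_trans T E x (sigma x)) /\
  (forall x y, clos_refl_sym_trans T E x y -> sigma x = sigma y).

(** The choice of the transversals is immaterial; it is made before that of
    the terms. *)
Definition satisfies_EqC (S : signature) (V : algebra S -> Prop) (m : nat)
    (r q : cterm m) : Prop :=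
  forall sigma : 'I_m -> 'I_(nvert r) -> 'I_(nvert r),
  (forall s, transversal_of (@edge m r s) (sigma s)) ->
  exists t : 'I_(nvert q) -> term S 'I_(nvert r),
    [/\ t (vert1 q) = Var (vert1 r),
        t (vert2 q) = Var (vert2 r) &
        forall (s : 'I_m) (i j : 'I_(nvert q)), edge s i j ->
          satisfies_ceq V (rename (sigma s) (t i)) (rename (sigma s) (t j))].

Definition lhs (T : Type) (alpha beta gamma : relation T) : relation T :=
  rmeet alpha (rcomp beta gamma).

Definition lhs_term : cterm 3 :=
  CMeet (CVar (@Ordinal 3 0 isT))
        (CComp (CVar (@Ordinal 3 1 isT)) (CVar (@Ordinal 3 2 isT))).

Definition sandwich (T : Type) (R Q : relation T) : relation T :=
  rcomp R (rcomp Q R).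

Definition Gchoice (S : signature) (A : algebra S)
    (alpha beta gamma : relation A) (R : relation A) : Prop :=
  let d := rmeet beta (rjoin alpha gamma) in
  let e := rmeet gamma (rjoin alpha beta) in
  R = comm d d \/ R = comm e e.

Definition Fchoice (T : Type) (n : nat) (alpha beta gamma : relation T)
    (R : relation T) : Prop :=
  [\/ R = rmeet beta (herringbone n beta alpha gamma),
      R = rmeet beta (herringbone n beta gamma alpha),
      R = rmeet gamma (herringbone n gamma beta alpha) |
      R = rmeet gamma (herringbone n gamma alpha beta)].

(* Main.v *)
Require Import Defs.
From Stdlib Require Import Relations Classical ClassicalEpsilon.
From Stdlib Require Import FunctionalExtensionality PropExtensionality.
From mathcomp Require Import all_boot.

Set Implicit Arguments.
Unset Strict Implicit.
Unset Printing Implicit Defensive.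

(** (1) => (2): Let [F] be the free algebra on [x0, x1, x2] in the class of
    abelian algebras of the idempotent reduct, and apply (1) to the kernels of
    the substitutions identifying the ends of each edge of the graph of the left
    hand side. The elements of [F] witnessing the conclusion are idempotent
    terms, and an identity of the abelian algebras of the idempotent reduct holds
    modulo [[theta, theta]] on every [theta]-class of an algebra of [V].

    (2) => (3): Evaluate the terms at [x, y, z] with [(x, y)] in [alpha],
    [(x, z)] in [beta], [(z, y)] in [gamma]; the transversals correspond to the
    choices of [G].

    (3) => (4): Let [mu] be the union of the [beta /\ y^n(beta, alpha, gamma)],
    which is also that of the [beta /\ y^n(beta, gamma, alpha)]. Modulo [mu],
    [beta] meets [alpha] and [gamma] trivially, so both centralize it, whence
    [[beta /\ (alpha \/ gamma), beta /\ (alpha \/ gamma)] <= mu]. A single [n]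
    suffices by compactness in the free algebra of [V] on three generators.

    (4) => (1): The equation in (4) transfers to the idempotent reduct. It fails
    on a 3-element set, where the herringbone terms add nothing to [p], so the
    idempotent reduct has a Taylor term. Hence its abelian algebras satisfy a
    two-term condition, by which the kernels considered in (1) => (2) have
    pairwise trivial intersection in [F]. For such congruences the equation
    in (4) is that in (1), and what holds for the generators of [F] carries over
    to all abelian algebras of the idempotent reduct. *)

(** * Terms, quotients and relatively free algebras *)

Fixpoint subst (S : signature) (X Y : Type) (f : X -> term S Y)
    (t : term S X) : term S Y :=
  match t with
  | Var x => f x
  | App g ts => App g (fun i => subst f (ts i))
  end.

Lemma eval_ext (S : signature) (A : algebra S) (X : Type) (e e' : X -> A) t :
  e =1 e' -> eval e t = eval e' t.
Proof. by move=> h; congr eval; apply: functional_extensionality. Qed.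

Lemma eval_subst (S : signature) (A : algebra S) (X Y : Type)
    (f : X -> term S Y) (e : Y -> A) t :
  eval e (subst f t) = eval (fun x => eval e (f x)) t.
Proof.
elim: t => //= g ts IH; congr interp.
by apply: functional_extensionality => i; apply: IH.
Qed.

Lemma eval_rename (S : signature) (A : algebra S) (X Y : Type)
    (s : X -> Y) (e : Y -> A) t :
  eval e (rename s t) = eval (fun x => e (s x)) t.
Proof.
elim: t => //= g ts IH; congr interp.
by apply: functional_extensionality => i; apply: IH.
Qed.

Lemma eval_congr (S : signature) (A : algebra S) (R : relation A) (X : Type)
    (e e' : X -> A) t :
  congruence R -> (forall x, R (e x) (e' x)) -> R (eval e t) (eval e' t).
Proof. by move=> [_ hR] h; elim: t => //= g ts IH; apply: hR. Qed.

Definition term_alg (S : signature) (X : Type) (hX : inhabited X) : algebra S :=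
  @Algebra S (term S X) (fun f ts => App f ts)
    (match hX with inhabits x => inhabits (Var x) end).

Lemma eval_term_alg (S : signature) (X Y : Type) (hX : inhabited X)
    (e : Y -> term_alg S hX) t :
  eval e t = subst e t.
Proof.
elim: t => //= g ts IH; congr App.
by apply: functional_extensionality => i; apply: IH.
Qed.

Section Quotient.

Variables (S : signature) (A : algebra S) (d : relation A).
Hypothesis hd : congruence d.

(** Classes are stored as predicates, so that related elements have Leibniz equal classes;
    satisfaction of identities and abelianness are both stated with [=]. *)
Definition qcarrier := {P : A -> Prop | exists x, P = d x}.

Definition qcls (x : A) : qcarrier :=
  exist _ (d x) (ex_intro (fun y => d x = d y) x erefl).

Definition qrepr (q : qcarrier) : A :=
  sval (constructive_indefinite_description _ (svalP q)).

Lemma qcls_eq x y : qcls x = qcls y <-> d x y.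
Proof.
case: hd => -[re tr sy] _; split=> [[->]|xy]; first exact: re.
apply: eq_sig_hprop => [P|] /=; first exact: proof_irrelevance.
apply: functional_extensionality => z; apply: propositional_extensionality.
by split=> h; [apply: tr (sy _ _ xy) h | apply: tr xy h].
Qed.

Lemma qreprK q : qcls (qrepr q) = q.
Proof.
rewrite /qrepr; case: constructive_indefinite_description => x /= hx.
by apply: eq_sig_hprop => [P|] /=; first exact: proof_irrelevance.
Qed.

Lemma qclsK x : d (qrepr (qcls x)) x.
Proof. by apply/qcls_eq; rewrite qreprK. Qed.

Definition quot : algebra S :=
  @Algebra S qcarrier (fun f a => qcls (interp (fun i => qrepr (a i))))
    (match carrier_inhabited A with inhabits x => inhabits (qcls x) end).

Lemma eval_quot (X : Type) (e : X -> A) t :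
  eval (A := quot) (fun x => qcls (e x)) t = qcls (eval e t).
Proof.
elim: t => //= g ts IH; apply/qcls_eq; case: hd => _; apply=> i.
by rewrite IH; apply: qclsK.
Qed.

End Quotient.

(** * Abelian algebras and the term condition *)

Lemma abelian_centralizes (S : signature) (A : algebra S) :
  abelian A -> centralizes (fun _ _ : A => True) (fun _ _ => True) eq.
Proof.
move=> ab n m f a b u v ha hu h; apply/ab.
have [_ hc _] := commP (fun _ _ : A => True) (fun _ _ => True).
by apply: (hc n m f a b u v) => //; apply/ab.
Qed.

Lemma centralizes_abelian (S : signature) (A : algebra S) :
  centralizes (fun _ _ : A => True) (fun _ _ => True) eq -> abelian A.
Proof.
move=> c x y; split=> [h|->].
  apply: h => //; split.
    by split=> [//|? ? ? -> ->|? ? ->].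
  by move=> f a b ab; congr interp; apply: functional_extensionality.
by case: (commP (fun _ _ : A => True) (fun _ _ => True)) => -[[re _ _] _] _ _.
Qed.

Lemma quot_abelian (S : signature) (A : algebra S) (d : relation A)
    (hd : congruence d) :
  centralizes (fun _ _ : A => True) (fun _ _ => True) d -> abelian (quot d).
Proof.
move=> c; apply: centralizes_abelian => n m f a b u v _ _.
(* The constants of the polynomial are replaced by representatives, which turns it into a polynomial
   of [A]. *)
pose r (x : 'I_n + 'I_m + quot d) : 'I_n + 'I_m + A :=
  match x with inl z => inl z | inr q => inr (qrepr q) end.
have E a' u' : peval f a' u' =
    qcls d (peval (rename r f) (fun i => qrepr (a' i)) (fun j => qrepr (u' j))).
  rewrite /peval eval_rename -(eval_quot hd); apply: (@eval_ext S (quot d)).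
  by move=> [[i|j]|q] /=; rewrite qreprK.
rewrite !E => /(qcls_eq hd) h; apply/(qcls_eq hd).
exact: c h.
Qed.

(** Both blocks of the polynomial are indexed by all of [X], and [D] decides from which block a
    variable is read; this avoids splitting [X] into two ordinals. *)
Lemma term_condition (S : signature) (A : algebra S) (X : finType)
    (f : term S X) (D : pred X) (a b u v : X -> A) :
  abelian A ->
  eval (fun x => if D x then a x else u x) f =
    eval (fun x => if D x then a x else v x) f ->
  eval (fun x => if D x then b x else u x) f =
    eval (fun x => if D x then b x else v x) f.
Proof.
move=> /abelian_centralizes ab.
pose r (x : X) : 'I_#|X| + 'I_#|X| + A :=
  inl (if D x then inl (enum_rank x) else inr (enum_rank x)).
have E a' u' : eval (fun x => if D x then a' x else u' x) f =
    peval (rename r f) (fun i => a' (enum_val i)) (fun j => u' (enum_val j)).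
  rewrite /peval eval_rename; apply: eval_ext => x; rewrite /r.
  by case: ifP => _; rewrite enum_rankK.
by rewrite !E; apply: ab.
Qed.

(** * Identities of a class and quotients of term algebras *)

Definition ident (S : signature) (K : algebra S -> Prop) (X : Type)
    (t t' : term S X) : Prop :=
  forall A : algebra S, K A -> forall g : X -> A, eval g t = eval g t'.

Lemma ident_congruence (S : signature) (K : algebra S -> Prop) (X : Type)
    (hX : inhabited X) :
  congruence (A := term_alg S hX) (ident K (X := X)).
Proof.
split; first split.
- by move=> t A _ g.
- by move=> t1 t2 t3 h h' A hA g; rewrite h ?h'.
- by move=> t1 t2 h A hA g; rewrite h.
- move=> f a b h A hA g /=; congr interp.
  by apply: functional_extensionality => i; apply: h.
Qed.

Lemma quot_variety (S : signature) (K W : algebra S -> Prop) (X : Type)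
    (hX : inhabited X) (d : relation (term_alg S hX)) (hd : congruence d) :
  is_variety W -> (forall A, K A -> W A) ->
  (forall t t', ident K t t' -> d t t') -> W (quot d).
Proof.
move=> [E hE] KW hK; apply/hE => s t st e.
have -> : e = fun x => qcls d (qrepr (e x)).
  by apply: functional_extensionality => x; rewrite qreprK.
rewrite !(eval_quot hd); apply/(qcls_eq hd); rewrite !eval_term_alg; apply: hK.
move=> A /KW/hE hA g; rewrite !eval_subst; exact: hA.
Qed.

Lemma eval_generic (S : signature) (X : Type)
    (hX : inhabited X) (d : relation (term_alg S hX)) (hd : congruence d) t :
  eval (A := quot d) (fun x => qcls d (Var x : term_alg S hX)) t = qcls d t.
Proof.
rewrite (eval_quot hd) eval_term_alg; congr qcls.
elim: t => //= g ts IH; congr App.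
by apply: functional_extensionality => i; apply: IH.
Qed.

(** The identities of the class in variables from [nat] define a variety containing [B]. Finitely
    many variables embed into [nat] by [val] and are read back by [inord], which requires at least
    one variable. *)
Lemma generated_variety_ident (S : signature) (K : algebra S -> Prop)
    (B : algebra S) (n : nat) (t t' : term S 'I_n.+1) (g : 'I_n.+1 -> B) :
  generated_variety K B -> ident K t t' -> eval g t = eval g t'.
Proof.
move=> hB tt'.
have: models (ident K (X := nat)) B.
  apply: hB; first by exists (ident K (X := nat)).
  by move=> A KA s s' h e; apply: h.
have E s : eval g s = eval (fun k => g (inord k)) (rename val s).
  by rewrite eval_rename; apply: eval_ext => i; rewrite inord_val.
rewrite !E; apply=> A KA e; rewrite !eval_rename; exact: tt'.
Qed.

(** * Relation terms *)

Section Simulation.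

Variables (T U : Type) (N : T -> Prop) (h : T -> U).

(** A simulation along paths that start in [N]: the invariant is assumed at the source only and is
    passed on to each point reached. It is used nontrivially for the idempotent elements of a free
    algebra. *)
Definition maps (R : relation T) (Q : relation U) : Prop :=
  forall x y, N x -> R x y -> N y /\ Q (h x) (h y).

Lemma rcomp_maps R R' Q Q' :
  maps R Q -> maps R' Q' -> maps (rcomp R R') (rcomp Q Q').
Proof.
move=> m m' x y Nx [z xz zy]; have [Nz hz] := m _ _ Nx xz.
have [Ny hy] := m' _ _ Nz zy; by split=> //; exists (h z).
Qed.

Lemma rjoin_maps R R' Q Q' :
  maps R Q -> maps R' Q' -> maps (rjoin R R') (rjoin Q Q').
Proof.
move=> m m'.
suff H k : maps (alt (@rcomp T) k R R') (alt (@rcomp U) k Q Q').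
  by move=> x y Nx [k /(H _ _ _ Nx) [Ny ?]]; split=> //; exists k.
elim: k R R' Q Q' m m' => [|k IH] R R' Q Q' m m' //.
by case: k IH => [|k] IH //; apply: rcomp_maps => //; apply: IH.
Qed.

Lemma jval_maps m (e : 'I_m -> relation T) (e' : 'I_m -> relation U) p :
  (forall s, maps (e s) (e' s)) -> maps (jval e p) (jval e' p).
Proof.
move=> he; elim: p => /= [s|q IHq r IHr|q IHq r IHr|q IHq r IHr] //.
- exact: rcomp_maps.
- move=> x y Nx [h1 h2].
  by have [Ny ?] := IHq _ _ Nx h1; have [_ ?] := IHr _ _ Nx h2.
- exact: rjoin_maps.
Qed.

End Simulation.

Lemma jval_mono m T (e e' : 'I_m -> relation T) p :
  (forall s, rle (e s) (e' s)) -> rle (jval e p) (jval e' p).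
Proof.
move=> he x y h.
have he' s : maps (fun=> True) id (e s) (e' s) by move=> u v _ /he.
by have [] := jval_maps he' I h.
Qed.

Lemma rjoin_mono T (R R' Q Q' : relation T) :
  rle R Q -> rle R' Q' -> rle (rjoin R R') (rjoin Q Q').
Proof.
move=> h h' x y j.
have [//|//|_ //] := @rjoin_maps T T (fun=> True) id R R' Q Q' _ _ x y I j.
- by move=> u v _ /h.
- by move=> u v _ /h'.
Qed.

Lemma alt_mono T k (R R' Q Q' : relation T) :
  rle R Q -> rle R' Q' -> rle (alt (@rcomp T) k R R') (alt (@rcomp T) k Q Q').
Proof.
elim: k R R' Q Q' => [|k IH] R R' Q Q' RQ RQ' //.
case: k IH => [|k] IH // u v [w /RQ uw wv]; exists w => //.
exact: (IH R' R Q' Q).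
Qed.

Section Directed.

Variables (T I : Type) (le : relation I).
Hypothesis directed : forall i j, exists2 k, le i k & le j k.

Lemma rjoin_directed (R R' : I -> relation T) :
  (forall i j, le i j -> rle (R i) (R j)) ->
  (forall i j, le i j -> rle (R' i) (R' j)) ->
  forall x y, rjoin (fun x y => exists i, R i x y)
                    (fun x y => exists i, R' i x y) x y ->
  exists i, rjoin (R i) (R' i) x y.
Proof.
move=> mR mR' x y [k hk].
suff [i hi]: exists i, alt (@rcomp T) k (R i) (R' i) x y by exists i, k.
elim: k R R' mR mR' x hk => [|k IH] R R' mR mR' x //.
case: k IH => [|k] IH //= [z [i xz] /(IH _ _ mR' mR) [j zy]].
have [l il jl] := directed i j; exists l; exists z; first exact: mR xz.
have {}zy: alt (@rcomp T) k.+1 (R' j) (R j) z y by [].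
exact: (alt_mono (k := k.+1) (mR' j l jl) (mR j l jl) zy).
Qed.

(** Compactness: membership of one pair in the value of [p] uses finitely many related pairs, and
    directedness yields one index covering them all. *)
Lemma jval_directed m (e : I -> 'I_m -> relation T) p :
  (forall i j s, le i j -> rle (e i s) (e j s)) ->
  forall x y, jval (fun s x y => exists i, e i s x y) p x y ->
  exists i, jval (e i) p x y.
Proof.
move=> me.
have mj q i j : le i j -> rle (jval (e i) q) (jval (e j) q).
  by move=> ij; apply: jval_mono => s; apply: me.
elim: p => /= [s|q IHq r IHr|q IHq r IHr|q IHq r IHr] x y //.
- move=> [z /IHq [i xz] /IHr [j zy]]; have [k ik jk] := directed i j.
  by exists k; exists z; [apply: mj xz|apply: mj zy].
- move=> [/IHq [i xz] /IHr [j zy]]; have [k ik jk] := directed i j.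
  by exists k; split; [apply: mj ik _ _ xz|apply: mj jk _ _ zy].
- move=> /(rjoin_mono IHq IHr); apply: rjoin_directed; exact: mj.
Qed.

End Directed.

Lemma alt_ind T (R Q : relation T) (P : T -> Prop) k x y :
  (forall u v, R u v -> P u -> P v) -> (forall u v, Q u v -> P u -> P v) ->
  alt (@rcomp T) k R Q x y -> P x -> P y.
Proof.
elim: k R Q x => [|k IH] R Q x hR hQ; first exact: hR.
case: k IH => [|k] IH; first exact: hR.
by move=> [z /hR xz zy] /xz; apply: (IH Q R) zy.
Qed.

Lemma rjoin_ind T (R Q : relation T) (P : T -> Prop) x y :
  (forall u v, R u v -> P u -> P v) -> (forall u v, Q u v -> P u -> P v) ->
  rjoin R Q x y -> P x -> P y.
Proof. by move=> hR hQ [k]; apply: alt_ind. Qed.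

Lemma alt_leq T (R Q : relation T) k l :
  (forall x, R x x) -> (forall x, Q x x) -> k <= l ->
  rle (alt (@rcomp T) k R Q) (alt (@rcomp T) l R Q).
Proof.
elim: k l R Q => [|k IH] l R Q reR reQ.
  move=> _ x y /= xy; case: l => [|[|l]] //=; exists y => //.
  elim: l R Q {xy} reR reQ => [|l IHl] R Q reR reQ; first exact: reQ.
  by exists y; [apply: reQ|apply: IHl].
case: l => // l; rewrite ltnS => kl.
case: k IH kl => [|k] IH kl x y /=.
  case: l kl => //= l _ xy; exists y => //.
  elim: l R Q {xy} reR reQ => [|l IHl] R Q reR reQ; first exact: reQ.
  by exists y; [apply: reQ|apply: IHl].
case: l kl => // l kl [z xz zy]; exists z => //.
exact: (IH l.+1 Q R).
Qed.

Section RJoin.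

Variables (T : Type) (R Q : relation T).
Hypotheses (eR : equivalence T R) (eQ : equivalence T Q).

Lemma rjoin_l : rle R (rjoin R Q).
Proof. by move=> x y; exists 0. Qed.

Lemma rjoin_r : rle Q (rjoin R Q).
Proof. by move=> x y; exists 2; exists x => //; case: eR. Qed.

Lemma rjoinS x y : rjoin R Q x y -> exists k, alt (@rcomp T) k.+1 R Q x y.
Proof. by move=> [[|k] h]; [exists 0|exists k]. Qed.

Lemma rjoin_refl x : rjoin R Q x x.
Proof. by apply: rjoin_l; case: eR. Qed.

Lemma rjoin_consl x y z : R x y -> rjoin R Q y z -> rjoin R Q x z.
Proof.
have [reQ _ _] := eQ => xy /rjoinS [k yz]; exists k.+3; exists y => //.
suff: rcomp Q (alt (@rcomp T) k.+1 R Q) y z by [].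
by exists y.
Qed.

Lemma rjoin_consr x y z : Q x y -> rjoin R Q y z -> rjoin R Q x z.
Proof.
have [reR _ _] := eR => xy /rjoinS [k yz]; exists k.+3; exists x => //.
suff: rcomp Q (alt (@rcomp T) k.+1 R Q) x z by [].
by exists y.
Qed.

Lemma rjoin_trans x y z : rjoin R Q x y -> rjoin R Q y z -> rjoin R Q x z.
Proof.
move=> xy; apply: (rjoin_ind (P := fun v => rjoin R Q v z -> rjoin R Q x z)) xy _ => //.
- by move=> u v uv IH /(rjoin_consl uv).
- by move=> u v uv IH /(rjoin_consr uv).
Qed.

Lemma rjoin_sym x y : rjoin R Q x y -> rjoin R Q y x.
Proof.
have [_ _ syR] := eR; have [_ _ syQ] := eQ => xy.
apply: (rjoin_ind (P := fun v => rjoin R Q v x)) xy (rjoin_refl x).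
- by move=> u v /syR uv; apply: rjoin_consl.
- by move=> u v /syQ uv; apply: rjoin_consr.
Qed.

Lemma rjoin_equivalence : equivalence T (rjoin R Q).
Proof. split; [exact: rjoin_refl|exact: rjoin_trans|exact: rjoin_sym]. Qed.

End RJoin.

Lemma rjoinC T (R Q : relation T) :
  equivalence T R -> equivalence T Q -> rle (rjoin R Q) (rjoin Q R).
Proof.
move=> eR eQ x y xy.
apply: (rjoin_ind (P := rjoin Q R x)) xy (rjoin_refl _ eQ x).
- by move=> u v uv xu; apply: (rjoin_trans eQ eR xu); apply: rjoin_r.
- by move=> u v uv xu; apply: (rjoin_trans eQ eR xu); apply: rjoin_l.
Qed.

Lemma rmeet_equivalence T (R Q : relation T) :
  equivalence T R -> equivalence T Q -> equivalence T (rmeet R Q).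
Proof.
move=> [r t s] [r' t' s']; split=> [x|x y z [? ?] [? ?]|x y [? ?]].
- by split.
- by split; [apply: t|apply: t']; eassumption.
- by split; [apply: s|apply: s'].
Qed.

(** * Congruences *)

(** The coordinates are exchanged one at a time along [enum I]; as the list has no repetitions, the
    coordinate to be exchanged still has its value under [a]. *)
Lemma telescope (I : finType) (A : Type) (R : relation A)
    (P : (I -> A) -> Prop) (a b : I -> A) :
  (forall c i x, R (c i) x -> P c -> P (fun j => if j == i then x else c j)) ->
  (forall i, R (a i) (b i)) -> P a -> P b.
Proof.
move=> step ab Pa.
pose c (s : seq I) := fun j => if j \in s then b j else a j.
suff H s : uniq s -> P (c s).
  have -> : b = c (enum I).
    by apply: functional_extensionality => j; rewrite /c mem_enum.
  exact/H/enum_uniq.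
elim: s => [_|i s IH /= /andP[ins /IH Ps]] //.
have -> : c (i :: s) = fun j => if j == i then b i else c s j.
  apply: functional_extensionality => j; rewrite /c inE.
  by case: eqP => [->|].
by apply: step Ps; rewrite /c (negbTE ins).
Qed.

Section Congruence.

Variables (S : signature) (A : algebra S).

Lemma congruence1 (R : relation A) :
  equivalence A R ->
  (forall (f : op S) (a : 'I_(arity f) -> A) i x, R (a i) x ->
     R (interp a) (interp (fun j => if j == i then x else a j))) ->
  congruence R.
Proof.
move=> eR h; split=> // f a b ab; case: (eR) => re tr _.
apply: (telescope (R := R) (P := fun c => R (interp a) (interp c))) ab (re _).
by move=> c i x cx ac; apply: tr ac _; apply: h.
Qed.

Lemma congruence_upd (R : relation A) (f : op S) (a : 'I_(arity f) -> A) i x :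
  congruence R -> R (a i) x ->
  R (interp a) (interp (fun j => if j == i then x else a j)).
Proof.
move=> [[re _ _] h] ax; apply: h => j; case: eqP => [->|_] //.
Qed.

Lemma rmeet_congruence (R Q : relation A) :
  congruence R -> congruence Q -> congruence (rmeet R Q).
Proof.
move=> [eR hR] [eQ hQ]; split; first exact: rmeet_equivalence.
by move=> f a b ab; split; [apply: hR|apply: hQ] => i; case: (ab i).
Qed.

Lemma rjoin_congruence (R Q : relation A) :
  congruence R -> congruence Q -> congruence (rjoin R Q).
Proof.
move=> cR cQ; have [eR _] := cR; have [eQ _] := cQ.
have eJ := rjoin_equivalence eR eQ.
apply: congruence1 => // f a i x ax.
pose u v := interp (fun j => if j == i then v else a j).
have cu (C : relation A) v w : congruence C -> C v w -> C (u v) (u w).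
  by move=> [[reC _ _] hC] vw; apply: hC => j; case: ifP.
have -> : interp a = u (a i).
  by congr interp; apply: functional_extensionality => j; case: eqP => [->|].
apply: (rjoin_ind (P := fun v => rjoin R Q (u (a i)) (u v))) ax (rjoin_refl Q eR _).
- by move=> v w /(cu _ _ _ cR)/(rjoin_l Q) vw av; apply: (rjoin_trans eR eQ av).
- by move=> v w /(cu _ _ _ cQ)/(rjoin_r eR) vw av; apply: (rjoin_trans eR eQ av).
Qed.

Lemma herringbone_congruence n (x y z : relation A) :
  congruence x -> congruence y -> congruence z -> congruence (herringbone n x y z).
Proof.
move=> cx; elim: n y z => [|n IH] y z cy cz //=.
by apply: rjoin_congruence => //; apply: rmeet_congruence => //; apply: IH.
Qed.

End Congruence.

Lemma herringbone_leq T n l (x y z : relation T) :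
  n <= l -> rle (herringbone n x y z) (herringbone l x y z).
Proof.
elim: n l y z => [|n IH] l y z.
  by case: l => [|l] _ //; apply: rjoin_l.
case: l => // l; rewrite ltnS => nl /=; apply: rjoin_mono => // u v [xuv h].
by split=> //; apply: IH h.
Qed.

(** By induction the inner herringbone lies in [z], so its meet with [x] is trivial and the join
    adds nothing to [y]. *)
Lemma herringbone_trivial T n (x y z : relation T) :
  equivalence T y -> equivalence T z ->
  (forall u v, rmeet x y u v -> u = v) -> (forall u v, rmeet x z u v -> u = v) ->
  rle (herringbone n x y z) y.
Proof.
elim: n y z => [|n IH] y z ey ez xy xz //= u v h.
case: (ey) => re tr _.
apply: (rjoin_ind (P := y u)) h (re u) => a b; first by move=> ab ua; apply: tr ab.
by move=> [xab /(IH _ _ ez ey xz xy) zab]; rewrite (xz a b).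
Qed.

(** * Labelled graphs *)

Fixpoint cval (m : nat) (T : Type) (e : 'I_m -> relation T) (r : cterm m) :
    relation T :=
  match r with
  | CVar s => e s
  | CComp q r => rcomp (cval e q) (cval e r)
  | CMeet q r => rmeet (cval e q) (cval e r)
  end.

Lemma cval_alt m T (e : 'I_m -> relation T) k q r :
  cval e (alt (@CComp m) k q r) = alt (@rcomp T) k (cval e q) (cval e r).
Proof. by elim: k q r => [|[|k] IH] q r //; exact: (congr1 (rcomp _) (IH r q)). Qed.

Lemma cval_unjoin m T (e : 'I_m -> relation T) k p :
  rle (cval e (unjoin k p)) (jval e p).
Proof.
elim: p => /= [s|q IHq r IHr|q IHq r IHr|q IHq r IHr] x y //.
- by move=> [z /IHq xz /IHr zy]; exists z.
- by move=> [/IHq ? /IHr].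
- by rewrite cval_alt => h; exists k; apply: (alt_mono (k := k) IHq IHr).
Qed.

Lemma leq_directed (i j : nat) : exists2 k, i <= k & j <= k.
Proof. by exists (maxn i j); [apply: leq_maxl|apply: leq_maxr]. Qed.

(** The bound is claimed for all larger [k], so that the bounds of subterms can be combined by
    [maxn]; reflexivity allows the alternating products to be lengthened. *)
Lemma jval_unjoin m T (e : 'I_m -> relation T) p x y :
  (forall s u, e s u u) -> jval e p x y ->
  exists k0, forall k, k0 <= k -> cval e (unjoin k p) x y.
Proof.
move=> re; have rc r u : cval e r u u.
  by elim: r => //= q hq r hr; exists u.
elim: p x y => /= [s|q IHq r IHr|q IHq r IHr|q IHq r IHr] x y.
- by exists 0.
- move=> [z /IHq [i hi] /IHr [j hj]]; exists (maxn i j) => k.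
  by rewrite geq_max => /andP[/hi xz /hj zy]; exists z.
- move=> [/IHq [i hi] /IHr [j hj]]; exists (maxn i j) => k.
  by rewrite geq_max => /andP[/hi ? /hj].
- pose R q k0 : relation T :=
    fun x y => forall k, k0 <= k -> cval e (unjoin k q) x y.
  have mR q' i j : i <= j -> rle (R q' i) (R q' j).
    by move=> ij u v h k jk; apply: h; apply: leq_trans jk.
  move=> /(rjoin_mono IHq IHr)/(rjoin_directed leq_directed (mR q) (mR r)).
  move=> [i [l h]]; exists (maxn i l) => k; rewrite geq_max => /andP[ik lk].
  rewrite cval_alt; apply: (alt_leq _ _ lk) => //.
  by apply: (alt_mono (k := l) _ _ h) => u v; apply.
Qed.

Lemma graph_cval m T (e : 'I_m -> relation T) r i j k (v : nat -> T) :
  (forall a b s, (a, b, s) \in (expand r i j k).2 -> e s (v a) (v b)) ->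
  cval e r (v i) (v j).
Proof.
elim: r i j k => /= [s|q IHq r IHr|q IHq r IHr] i j k.
- by apply; rewrite inE.
- have := IHq i k.+2 k.+1; case: (expand q _ _ _) => k1 E1 /= hq.
  have := IHr k.+2 j k1; case: (expand r _ _ _) => k2 E2 /= hr h.
  exists (v k.+2); [apply: hq|apply: hr] => a b s abs; apply: h;
    by rewrite mem_cat abs ?orbT.
- have := IHq i j k; case: (expand q _ _ _) => k1 E1 /= hq.
  have := IHr i j k1; case: (expand r _ _ _) => k2 E2 /= hr h.
  split; [apply: hq|apply: hr] => a b s abs; apply: h;
    by rewrite mem_cat abs ?orbT.
Qed.

(** Conversely to [graph_cval], the midpoints witnessing the compositions become the values of [w]
    at the added vertices. *)
Lemma cval_graph m T (e : 'I_m -> relation T) r i j k (v : nat -> T) :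
  i < k.+2 -> j < k.+2 -> cval e r (v i) (v j) ->
  exists2 w : nat -> T, (forall n, n < k.+2 -> w n = v n) &
    forall a b s, (a, b, s) \in (expand r i j k).2 -> e s (w a) (w b).
Proof.
(* Expanding the second subterm only assigns vertices beyond those of the first, so the edges of the
   first stay valid. *)
have glue k1 (E1 E2 : seq (nat * nat * 'I_m)) (w1 w2 : nat -> T) :
    all (fun e => (e.1.1 < k1) && (e.1.2 < k1)) E1 ->
    (forall n, n < k1 -> w2 n = w1 n) ->
    (forall a b s, (a, b, s) \in E1 -> e s (w1 a) (w1 b)) ->
    (forall a b s, (a, b, s) \in E2 -> e s (w2 a) (w2 b)) ->
    forall a b s, (a, b, s) \in E1 ++ E2 -> e s (w2 a) (w2 b).
  move=> /allP bd ww h1 h2 a b s; rewrite mem_cat => /orP[h|/h2 //].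
  by have /andP[/= /ww -> /ww ->] := bd _ h; apply: h1.
elim: r i j k v => [s|q IHq r IHr|q IHq r IHr] i j k v ik jk /=.
- by move=> h; exists v => // a b t; rewrite inE => /eqP[-> -> ->].
- move=> [z xz zy].
  pose v1 n := if n == k.+2 then z else v n.
  have v1E n : n < k.+2 -> v1 n = v n by rewrite /v1; case: ltngtP.
  have v1k : v1 k.+2 = z by rewrite /v1 eqxx.
  have hq : cval e q (v1 i) (v1 k.+2) by rewrite v1E // v1k.
  have [w1] := IHq i k.+2 k.+1 v1 (ltnW ik) (ltnSn _) hq.
  have := @expand_bound m q i k.+2 k.+1 (ltnW ik) (ltnSn _).
  case: (expand q _ _ _) => k1 E1 /= [k1k bd] w1v w1e.
  have jk1 : j < k1.+2 by rewrite (leq_trans jk) // !ltnS ltnW.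
  have hr : cval e r (w1 k.+2) (w1 j).
    by rewrite !w1v ?v1k ?v1E // ltnW.
  have [w2 w2w w2e] := IHr k.+2 j k1 w1 k1k jk1 hr.
  move: w2e; case: (expand r _ _ _) => k2 E2 /= w2e.
  exists w2; last exact: glue _ _ _ _ _ bd w2w w1e w2e.
  move=> n nk; rewrite w2w ?w1v ?v1E //; first by rewrite ltnW.
  by rewrite (leq_trans nk) // !ltnS ltnW.
- move=> [hq hr].
  have [w1] := IHq i j k v ik jk hq.
  have := @expand_bound m q i j k ik jk.
  case: (expand q _ _ _) => k1 E1 /= [k1k bd] w1v w1e.
  have kk1 n : n < k.+2 -> n < k1.+2 by move=> h; apply: leq_trans h _.
  have [|w2 w2w w2e] := IHr i j k1 w1 (kk1 _ ik) (kk1 _ jk).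
    by rewrite !w1v.
  move: w2e; case: (expand r _ _ _) => k2 E2 /= w2e.
  exists w2; last exact: glue _ _ _ _ _ bd w2w w1e w2e.
  by move=> n nk; rewrite w2w ?w1v //; apply: kk1.
Qed.

(** * Commutators and herringbone terms *)

Section CommHerringbone.

Variables (S : signature) (A : algebra S) (x y z : relation A).
Hypotheses (cx : congruence x) (cy : congruence y) (cz : congruence z).

Definition herringbone_limit : relation A :=
  fun u v => exists n, rmeet x (herringbone n x y z) u v.

Let cn n : congruence (rmeet x (herringbone n x y z)).
Proof. by apply: rmeet_congruence => //; apply: herringbone_congruence. Qed.

Lemma herringbone_limit_congruence : congruence herringbone_limit.
Proof.
apply: congruence1; first split.
- by move=> u; exists 0; have [[re _ _] _] := cn 0; apply: re.
- move=> u v w [i [uv uvi]] [j [vw vwj]]; exists (maxn i j).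
  case: (cn (maxn i j)) => -[_ tr _] _; apply: (tr u v w); split=> //.
    exact: herringbone_leq (leq_maxl _ _) _ _ uvi.
  exact: herringbone_leq (leq_maxr _ _) _ _ vwj.
- by move=> u v [i uv]; exists i; have [[_ _ sy] _] := cn i; apply: sy.
- by move=> f a i w [n an]; exists n; apply: congruence_upd.
Qed.

(** Two unfoldings give [y] joined with [x] meet ([z] joined with the level [n] relation); the path
    [p'], [p], [q], [q'] uses [y], then the inner meet, then [y]. *)
Lemma herringbone_limit_l p q p' q' :
  herringbone_limit p q -> x p' q' -> y p p' -> y q q' ->
  herringbone_limit p' q'.
Proof.
have [ey _] := cy; have [ez _] := cz; have [ex _] := cx.
move=> [n pq] xpq yp yq; exists n.+2; split=> //=.
have ez' := rjoin_equivalence ez (cn n).1.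
have em := rmeet_equivalence ex ez'.
apply: (rjoin_trans ey em (y := p)).
  by apply: rjoin_l; have [_ _ sy] := ey; apply: sy.
apply: (rjoin_trans ey em (y := q)); last exact: rjoin_l.
by apply: rjoin_r => //; split; [case: pq|apply: rjoin_r].
Qed.

(** Here the whole path [p'], [p], [q], [q'] lies in the inner join with [z], and [x p' q'] puts its
    ends into the meet. *)
Lemma herringbone_limit_r p q p' q' :
  herringbone_limit p q -> x p' q' -> z p p' -> z q q' ->
  herringbone_limit p' q'.
Proof.
have [ey _] := cy; have [ez _] := cz.
move=> [n pq] xpq zp zq; exists n.+2; split=> //=.
apply: rjoin_r => //; split=> //.
have em := (cn n).1.
apply: (rjoin_trans ez em (y := p)).
  by apply: rjoin_l; have [_ _ sy] := ez; apply: sy.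
by apply: (rjoin_trans ez em (y := q)); [apply: rjoin_r|apply: rjoin_l].
Qed.

(** Modulo [herringbone_limit], [x] meets both [y] and [z] trivially, hence
    [y] and [z], and with them [rjoin y z], centralize [x]. *)
Lemma comm_herringbone_limit :
  let d := rmeet x (rjoin y z) in rle (comm d d) herringbone_limit.
Proof.
move=> d u v; apply; first exact: herringbone_limit_congruence.
move=> n m f a b r s ab rs.
(* Each argument of the first block moves along a chain of [y]- and [z]-steps. The two values stay
   [x]-related, since the second block moves within [x], so the two preceding lemmas apply to every
   step. *)
apply: (telescope (R := rjoin y z)
  (P := fun c => herringbone_limit (peval f c r) (peval f c s))).
  move=> c i w cw hc.
  pose upd w' := fun j => if j == i then w' else c j.
  have E : c = upd (c i).
    by apply: functional_extensionality => j; rewrite /upd; case: eqP => [->|].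
  have cupd (R : relation A) t w1 w2 : congruence R -> R w1 w2 ->
      R (peval f (upd w1) t) (peval f (upd w2) t).
    move=> cR h; apply: eval_congr => // -[[j|j]|q]; case: (cR) => -[re _ _] _ //.
    by rewrite /upd; case: ifP.
  have cx' c' : x (peval f c' r) (peval f c' s).
    apply: eval_congr => // -[[j|j]|q]; case: (cx) => -[re _ _] _ //.
    by case: (rs j).
  apply: (rjoin_ind (P := fun w' => herringbone_limit (peval f (upd w') r)
                                      (peval f (upd w') s))) cw _.
  - move=> w1 w2 h h1; apply: herringbone_limit_l h1 _ _ _ => //; exact: cupd.
  - move=> w1 w2 h h1; apply: herringbone_limit_r h1 _ _ _ => //; exact: cupd.
  - by rewrite -E.
by move=> i; case: (ab i).
Qed.

End CommHerringbone.

(** * The two-term condition *)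

Section TwoTerm.

Variables (S : signature) (B : algebra S) (X : finType) (w : term S X).
Hypothesis abB : abelian B.
Hypothesis idem_w : forall x : B, eval (fun=> x) w = x.
Hypothesis taylor_w : forall i, exists P Q : pred X, [/\ P i, ~~ Q i &
  forall x y : B, eval (fun j => if P j then x else y) w =
                  eval (fun j => if Q j then x else y) w].

(** With blocks of variables [a] (where [D] holds) and [b], two terms that
    agree at [(a, b')], [(a', b)] and [(a', b')] agree at [(a, b)]. In
    [w (t (x_j, y_j))_j] the Taylor identity at [i] lets one move the value [a]
    of the [x_j] from the places in [P] to those in [Q], first for constant
    [y_j] and then, by abelianness, for arbitrary [y_j]; taking [y_i = b] and
    the other [y_j = b'] only the three known corners appear after the move. *)
Lemma two_term (I : finType) (t t' : term S I) (D : pred I)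
    (a b a' b' : I -> B) :
  let at_ (x y : I -> B) := eval (fun k => if D k then x k else y k) in
  at_ a b' t = at_ a b' t' -> at_ a' b t = at_ a' b t' ->
  at_ a' b' t = at_ a' b' t' -> at_ a b t = at_ a b t'.
Proof.
move=> at_ h1 h2 h3.
pose G (s : term S I) := subst (fun j : X => rename (pair j) s) w.
have evG s g : eval g (G s) = eval (fun j => eval (fun k => g (j, k)) s) w.
  by rewrite eval_subst; apply: eval_ext => j; rewrite eval_rename.
have move_ P Q s (y : X -> I -> B) :
    (forall x z : B, eval (fun j => if P j then x else z) w =
                     eval (fun j => if Q j then x else z) w) ->
    eval (fun j => at_ (if P j then a else a') (y j) s) w =
    eval (fun j => at_ (if Q j then a else a') (y j) s) w.
  move=> PQ.
  pose u (R : pred X) (jk : X * I) := (if R jk.1 then a else a') jk.2.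
  have E R (z : X -> I -> B) :
      eval (fun j => at_ (if R j then a else a') (z j) s) w =
      eval (fun jk : X * I => if ~~ D jk.2 then z jk.1 jk.2 else u R jk) (G s).
    rewrite evG; apply: eval_ext => j; apply: eval_ext => k /=.
    by rewrite /u; case: (D k).
  rewrite !E; apply: (@term_condition _ _ _ _ (fun jk => ~~ D jk.2)
    (fun jk => b' jk.2) (fun jk => y jk.1 jk.2)) => //.
  rewrite -(E P (fun=> b')) -(E Q (fun=> b')).
  have F (R : pred X) : eval (fun j => at_ (if R j then a else a') b' s) w =
      eval (fun j => if R j then at_ a b' s else at_ a' b' s) w.
    by apply: eval_ext => j; case: ifP.
  by rewrite !F PQ.
have one (i : X) (r : X -> B) :
    eval (fun j => if j == i then at_ a b t else r j) w =
    eval (fun j => if j == i then at_ a b t' else r j) w.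
  have [P [Q [Pi Qi PQ]]] := taylor_w i.
  pose y j := if j == i then b else b'.
  pose r0 (R : pred X) j := at_ (if R j then a else a') (y j).
  have E s : eval (fun j => if j == i then at_ a b s else r0 P j s) w =
             eval (fun j => r0 Q j s) w.
    rewrite -(move_ P Q s y PQ); apply: eval_ext => j.
    by case: eqP => // ->; rewrite Pi /y eqxx.
  have h : eval (fun j => if j == i then at_ a b t else r0 P j t) w =
           eval (fun j => if j == i then at_ a b t' else r0 P j t) w.
    rewrite E; transitivity (eval (fun j => r0 Q j t') w).
      apply: eval_ext => j; rewrite /r0 /y.
      by case: eqP => [->|_]; rewrite ?(negbTE Qi) //; case: ifP.
    rewrite -E; apply: eval_ext => j; case: eqP => // /eqP ji.
    by rewrite /r0 /y (negbTE ji); case: ifP.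
  (* A second use of the term condition replaces the special values at the places other than [i] by
     an arbitrary [r]. *)
  pose D' := fun j => j != i.
  have flip z (q : X -> B) : eval (fun j => if j == i then z else q j) w =
      eval (fun j => if D' j then q j else z) w.
    by apply: eval_ext => j; rewrite /D'; case: eqP.
  rewrite !flip; move: h; rewrite !flip.
  exact: (@term_condition _ _ _ w D' _ _ (fun=> _) (fun=> _) abB).
(* By idempotence both sides are values of [w] at constant tuples, which [one] transforms into each
   other place by place. *)
rewrite -[LHS]idem_w -[RHS]idem_w.
apply: (telescope (R := fun x y => x = at_ a b t /\ y = at_ a b t')
  (P := fun c => eval (fun=> at_ a b t) w = eval c w)) => //.
move=> c i x [ci ->] ->; rewrite -one; apply: eval_ext => j.
by case: eqP => [->|].
Qed.

End TwoTerm.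

(** Iterated composition of the terms of [L]; a variable is a tuple that holds one variable for each
    term. If the terms are idempotent, values that depend on one coordinate only collapse all terms
    but one. *)
Fixpoint star (S : signature) (I : Type) (L : seq (term S I)) :
    term S ((size L).-tuple I) :=
  match L with
  | [::] => Var [tuple]
  | t :: L' => subst (fun k => rename (cons_tuple k) (star L')) t
  end.

Lemma eval_star (S : signature) (B : algebra S) (I : Type) (L : seq (term S I))
    (t0 : term S I) (i : 'I_(size L)) (g : I -> B) :
  (forall (Y : Type) (t : term S Y) (x : B), eval (fun=> x) t = x) ->
  eval (fun K => g (tnth K i)) (star L) = eval g (nth t0 L i).
Proof.
move=> idem; elim: L i => [|t L IH] /= [i hi]; first by [].
rewrite eval_subst; case: i hi => [|i] hi /=.
  apply: eval_ext => k; rewrite eval_rename -[RHS](idem _ (star L) (g k)).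
  by apply: eval_ext => K.
have hi' : i < size L by [].
rewrite -[RHS](idem _ t); apply: eval_ext => k; rewrite eval_rename.
rewrite -(IH (Ordinal hi')); apply: eval_ext => K; congr g.
by rewrite !(tnth_nth k).
Qed.

(** * Three variables *)

Definition o0 : 'I_3 := @Ordinal 3 0 isT.
Definition o1 : 'I_3 := @Ordinal 3 1 isT.
Definition o2 : 'I_3 := @Ordinal 3 2 isT.

Lemma I3P (P : 'I_3 -> Prop) : P o0 -> P o1 -> P o2 -> forall s, P s.
Proof.
move=> h0 h1 h2 [[|[|[|//]]] h]; rewrite (bool_irrelevance h isT) //.
Qed.

Lemma jval3E T (e : 'I_3 -> relation T) p :
  jval3 p (e o0) (e o1) (e o2) = jval e p.
Proof.
congr jval; apply: functional_extensionality; by apply: I3P.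
Qed.

Fixpoint jsubst m n (f : 'I_m -> jterm n) (p : jterm m) : jterm n :=
  match p with
  | JVar s => f s
  | JComp q r => JComp (jsubst f q) (jsubst f r)
  | JMeet q r => JMeet (jsubst f q) (jsubst f r)
  | JJoin q r => JJoin (jsubst f q) (jsubst f r)
  end.

Lemma jval_subst m n T (e : 'I_n -> relation T) (f : 'I_m -> jterm n) p :
  jval e (jsubst f p) = jval (fun s => jval e (f s)) p.
Proof. by elim: p => //= q -> r ->. Qed.

Fixpoint jherr m n (x y z : jterm m) : jterm m :=
  match n with
  | 0 => y
  | n'.+1 => JJoin y (JMeet x (jherr n' x z y))
  end.

Lemma jval_herr m T (e : 'I_m -> relation T) n x y z :
  jval e (jherr n x y z) = herringbone n (jval e x) (jval e y) (jval e z).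
Proof. by elim: n y z => //= n IH y z; rewrite IH. Qed.

(** The four elements of [Fchoice], indexed by pairs of booleans. *)
Definition Frel T n (a b c : relation T) (i : bool * bool) : relation T :=
  let y := if i.1 then b else c in
  let z := if i.1 then c else b in
  rmeet y (if i.2 then herringbone n y a z else herringbone n y z a).

Definition Fterm n (a b c : 'I_3) (i : bool * bool) : jterm 3 :=
  let y := JVar (if i.1 then b else c) in
  let z := JVar (if i.1 then c else b) in
  JMeet y (if i.2 then jherr n y (JVar a) z else jherr n y z (JVar a)).

Lemma jval_Fterm T (e : 'I_3 -> relation T) n a b c i :
  jval e (Fterm n a b c i) = Frel n (e a) (e b) (e c) i.
Proof. by case: i => -[] [] /=; rewrite jval_herr. Qed.

Lemma Fchoice_Frel T n (a b c R : relation T) :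
  Fchoice n a b c R <-> exists i, R = Frel n a b c i.
Proof.
split.
  by case=> ->; [exists (true, true)|exists (true, false)|
                 exists (false, false)|exists (false, true)].
move=> [[[] []] ->]; rewrite /Frel /=;
  [exact: Or41|exact: Or42|exact: Or44|exact: Or43].
Qed.

Lemma Frel_leq T n l (a b c : relation T) i :
  n <= l -> rle (Frel n a b c i) (Frel l a b c i).
Proof.
move=> nl x y [h h']; split=> //.
by move: h'; case: ifP => _; apply: herringbone_leq.
Qed.

Definition trivial_meet T (R Q : relation T) : Prop :=
  forall x y, rmeet R Q x y -> x = y.

Lemma trivial_meetC T (R Q : relation T) :
  trivial_meet R Q -> trivial_meet Q R.
Proof. by move=> RQ x y [? ?]; apply: RQ. Qed.

Lemma Frel_trivial T n (a b c : relation T) i :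
  equivalence T a -> equivalence T b -> equivalence T c ->
  trivial_meet a b -> trivial_meet a c -> trivial_meet b c ->
  forall x y, Frel n a b c i x y -> x = y.
Proof.
move=> ea eb ec ab ac bc x y [h].
have ba := trivial_meetC ab; have ca := trivial_meetC ac.
have cb := trivial_meetC bc.
case: i h => -[] [] /= h hh.
- by apply: (ba); split=> //; apply: (herringbone_trivial ea ec ba bc hh).
- by apply: (bc); split=> //; apply: (herringbone_trivial ec ea bc ba hh).
- by apply: (ca); split=> //; apply: (herringbone_trivial ea eb ca cb hh).
- by apply: (cb); split=> //; apply: (herringbone_trivial eb ea cb ca hh).
Qed.

Definition Fsand T n (e : 'I_3 -> relation T) (i j l : bool * bool) (s : 'I_3) :
    relation T :=
  tnth [tuple sandwich (e o0) (Frel n (e o0) (e o1) (e o2) i);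
              sandwich (e o1) (Frel n (e o1) (e o0) (e o2) j);
              sandwich (e o2) (Frel n (e o2) (e o1) (e o0) l)] s.

(** The right hand side in (4) as a term in the original three variables, so that monotonicity,
    compactness and simulation apply to it directly. *)
Definition Pterm (p : jterm 3) n (i j l : bool * bool) : jterm 3 :=
  let sand a F := JComp (JVar a) (JComp F (JVar a)) in
  jsubst (tnth [tuple sand o0 (Fterm n o0 o1 o2 i); sand o1 (Fterm n o1 o0 o2 j);
                      sand o2 (Fterm n o2 o1 o0 l)]) p.

Lemma jval_Pterm T (e : 'I_3 -> relation T) p n i j l :
  jval e (Pterm p n i j l) = jval (Fsand n e i j l) p.
Proof.
rewrite jval_subst; congr jval; apply: functional_extensionality.
by apply: I3P; rewrite /Fsand /tnth /= -jval_Fterm.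
Qed.

Lemma Pterm_leq T (e : 'I_3 -> relation T) p n l i j k :
  n <= l -> rle (jval e (Pterm p n i j k)) (jval e (Pterm p l i j k)).
Proof.
move=> nl; rewrite !jval_Pterm; apply: jval_mono.
apply: I3P; move=> x y [z xz [w zw wy]];
  by exists z => //; exists w => //; apply: Frel_leq zw.
Qed.

Lemma Pterm_trivial T (e : 'I_3 -> relation T) p n i j l :
  (forall s, equivalence T (e s)) ->
  trivial_meet (e o0) (e o1) -> trivial_meet (e o0) (e o2) ->
  trivial_meet (e o1) (e o2) ->
  rle (jval e (Pterm p n i j l)) (jval e p).
Proof.
move=> ee e01 e02 e12; rewrite jval_Pterm; apply: jval_mono.
have sw s (F : relation T) : (forall x y, F x y -> x = y) ->
    rle (sandwich (e s) F) (e s).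
  move=> Fe x y [z xz [w /Fe <- zy]].
  by have [_ tr _] := ee s; apply: tr zy.
apply: I3P; apply: sw; apply: Frel_trivial => //; exact: trivial_meetC.
Qed.

(** The graph of [lhs_term] has the edges 0 to 1 for [alpha], 0 to 2 for [beta] and 2 to 1 for
    [gamma]. *)
Definition end1 (s : 'I_3) : 'I_3 := if s == o2 then o2 else o0.
Definition end2 (s : 'I_3) : 'I_3 := if s == o1 then o2 else o1.

(** Identifies the ends of the edge labelled [s] of the graph of [lhs_term]. *)
Definition identify (b : bool) (s k : 'I_3) : 'I_3 :=
  if (k == end1 s) || (k == end2 s) then (if b then end1 s else end2 s) else k.

(** * Kernels of substitutions in relatively free algebras *)

Section Kernels.

Variables (S : signature) (K : algebra S -> Prop) (X : Type) (hX : inhabited X).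

Definition mident (sigma : X -> X) : relation (term S X) :=
  fun t t' => ident K (rename sigma t) (rename sigma t').

Lemma mident_congruence sigma : congruence (A := term_alg S hX) (mident sigma).
Proof.
have [[re tr sy] co] := ident_congruence K hX.
split; first split.
- by move=> t; apply: re.
- by move=> t1 t2 t3; apply: tr.
- by move=> t1 t2; apply: sy.
- by move=> f a b; apply: co.
Qed.

Lemma ident_mident sigma t t' : ident K t t' -> mident sigma t t'.
Proof. by move=> h A hA g; rewrite !eval_rename; apply: h. Qed.

Lemma mident_eval sigma t t' (A : algebra S) (g : X -> A) :
  K A -> mident sigma t t' -> (forall k, g (sigma k) = g k) ->
  eval g t = eval g t'.
Proof.
move=> hA h gs; move: (h A hA g); rewrite !eval_rename.
by rewrite !(eval_ext _ gs).
Qed.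

Definition free : algebra S := quot (A := term_alg S hX) (ident K (X := X)).

Definition gen (x : X) : free := qcls (A := term_alg S hX) (ident K (X := X)) (Var x).

Definition mker (sigma : X -> X) : relation free :=
  fun x y => mident sigma (qrepr x) (qrepr y).

Lemma qcls_mker sigma t t' :
  mident sigma t t' ->
  mker sigma (qcls (A := term_alg S hX) (ident K (X := X)) t)
             (qcls (A := term_alg S hX) (ident K (X := X)) t').
Proof.
move=> h; have [[_ tr sy] _] := mident_congruence sigma.
apply: tr (tr _ _ _ _ h) _; first exact/ident_mident/(qclsK (ident_congruence K hX)).
exact/sy/ident_mident/(qclsK (ident_congruence K hX)).
Qed.

Lemma mker_congruence sigma : congruence (mker sigma).
Proof.
have [[re tr sy] co] := mident_congruence sigma.
split; first split.
- by move=> x; apply: re.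
- by move=> x y z; apply: tr.
- by move=> x y; apply: sy.
- by move=> f a b ab; apply/qcls_mker/co.
Qed.

Lemma mker_gen sigma x y : sigma x = sigma y -> mker sigma (gen x) (gen y).
Proof. by move=> h; apply: qcls_mker => A _ g /=; rewrite h. Qed.

Lemma eval_qrepr (A : algebra S) (g : X -> A) t :
  K A -> eval g (qrepr (qcls (A := term_alg S hX) (ident K (X := X)) t)) = eval g t.
Proof. by move=> hA; apply: (qclsK (ident_congruence K hX)). Qed.

(** The homomorphism given by [g] sends each element to a value [R]-related to that of its image
    under [sigma], and elements in the kernel share the latter. So membership at the generators
    carries over to [A]. *)
Lemma mker_maps (A : algebra S) (R : relation A) sigma (g : X -> A) :
  K A -> congruence R -> (forall k, R (g k) (g (sigma k))) ->
  maps (fun=> True) (fun q : free => eval g (qrepr q)) (mker sigma) R.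
Proof.
move=> hA cR gs x y _ xy; split=> //.
have h (q : free) : R (eval g (qrepr q)) (eval g (rename sigma (qrepr q))).
  by rewrite eval_rename; apply: (eval_congr _ cR).
have [[_ tr sy] _] := cR.
apply: tr (h x) _; rewrite (xy A hA g); exact: sy (h y).
Qed.

End Kernels.

Arguments gen {S} K {X} hX x : rename.
Arguments mker {S} K {X} hX sigma.

Lemma free_variety (S : signature) (V : algebra S -> Prop) (X : Type)
    (hX : inhabited X) : is_variety V -> V (free V hX).
Proof.
move=> hV; exact: (quot_variety (ident_congruence V hX) hV (fun _ => id) (fun _ _ => id)).
Qed.

Definition inh3 : inhabited 'I_3 := inhabits o0.

Lemma identify_ends b s : identify b s (end1 s) = identify b s (end2 s).
Proof. by rewrite /identify !eqxx orbT. Qed.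

(** * The idempotent reduct *)

Section Idempotent.

Variables (S : signature) (V : algebra S -> Prop).
Hypothesis hV : is_variety V.

Let Sid := idem_sig V.

Definition reducts (B : algebra Sid) : Prop :=
  exists2 A : algebra S, V A & B = idem_reduct_alg V A.

Fixpoint tr (X : Type) (t : term Sid X) : term S X :=
  match t with
  | Var x => Var x
  | App f ts => subst (fun i => tr (ts i)) (sval (projT2 f))
  end.

Lemma eval_tr (A : algebra S) (X : Type) (g : X -> A) (t : term Sid X) :
  eval (A := idem_reduct_alg V A) g t = eval g (tr t).
Proof.
elim: t => //= f ts IH; rewrite eval_subst; apply: eval_ext => i; exact: IH.
Qed.

Lemma tr_rename (X Y : Type) (s : X -> Y) (t : term Sid X) :
  ident V (tr (rename s t)) (rename s (tr t)).
Proof.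
by move=> A _ g; rewrite eval_rename -!eval_tr eval_rename.
Qed.

Lemma ident_tr (X : Type) (t t' : term Sid X) :
  ident reducts t t' <-> ident V (tr t) (tr t').
Proof.
split=> [h A hA g|h _ [A hA ->] g]; last by rewrite !eval_tr; apply: (h A hA).
rewrite -!eval_tr.
exact: (h (idem_reduct_alg V A) (ex_intro2 _ _ A hA erefl) g).
Qed.

Lemma mident_tr (X : Type) sigma (t t' : term Sid X) :
  mident reducts sigma t t' <-> mident V sigma (tr t) (tr t').
Proof.
split=> [/ident_tr h A hA g|h]; first by rewrite -!(tr_rename _ _ hA) ?h.
by apply/ident_tr => A hA g; rewrite !(tr_rename _ _ hA); apply: h.
Qed.

Lemma eval_idem (B : algebra Sid) (X : Type) (t : term Sid X) (x : B) :
  idem_reduct B -> eval (fun=> x) t = x.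
Proof.
move=> hB.
have -> : eval (fun=> x) t = eval (fun _ : 'I_1 => x) (rename (fun=> ord0) t).
  by rewrite eval_rename.
apply: (generated_variety_ident (t' := Var ord0) _ hB) => _ [A hA ->] g.
rewrite eval_rename /=; elim: t => //= f ts IH.
transitivity (eval (A := A) (fun=> g ord0) (sval (projT2 f))).
  by apply: eval_ext => i; apply: IH.
by case: f {ts IH} => n [t ht] /=; apply: ht.
Qed.

Definition idem_abelian (B : algebra Sid) : Prop := idem_reduct B /\ abelian B.

Lemma ident_idem_abelian n (t t' : term Sid 'I_n.+1) :
  ident reducts t t' -> ident idem_abelian t t'.
Proof. by move=> h B [hB _] g; apply: generated_variety_ident h. Qed.

Lemma quot_idem_abelian (n : nat) (hX : inhabited 'I_n.+1)
    (d : relation (term_alg Sid hX)) :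
  congruence d -> (forall t t', ident reducts t t' -> d t t') ->
  centralizes (fun _ _ => True) (fun _ _ => True) d -> idem_abelian (quot d).
Proof.
move=> hd rd cd; split; last exact: quot_abelian.
by move=> W hW KW; apply: (quot_variety hd hW KW).
Qed.

(** The term condition modulo [ident] can be checked after evaluation in each abelian algebra, where
    the constants of the polynomial become elements. *)
Lemma free_idem_abelian (n : nat) (hX : inhabited 'I_n.+1) :
  idem_abelian (free idem_abelian hX).
Proof.
apply: quot_idem_abelian.
- exact: ident_congruence.
- exact: ident_idem_abelian.
- move=> k m f a b u v _ _ h B hB g.
  pose r (x : 'I_k + 'I_m + term Sid 'I_n.+1) : 'I_k + 'I_m + B :=
    match x with inl z => inl z | inr t => inr (eval g t) end.
  have E a' u' : eval g (peval (A := term_alg Sid hX) f a' u') =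
      peval (rename r f) (fun i => eval g (a' i)) (fun j => eval g (u' j)).
    rewrite /peval eval_term_alg eval_subst eval_rename.
    by apply: eval_ext => -[[i|j]|t].
  move: (h B hB g); rewrite !E.
  exact: (abelian_centralizes hB.2).
Qed.

Lemma idempotent_tr (X : Type) (t : term Sid X) (A : algebra S) (x : A) :
  V A -> eval (fun=> x) (tr t) = x.
Proof.
move=> hA; rewrite -eval_tr; apply: (@eval_idem (idem_reduct_alg V A)).
by move=> W _; apply; exists A.
Qed.

(** * The Taylor term *)

Section Taylor.

Variables (P : jterm 3) (u1 u2 : term Sid 'I_3).
Hypotheses (hu1 : ident reducts u1 (Var o0)) (hu2 : ident reducts u2 (Var o1)).
Hypothesis hP : jval (fun s => mident reducts (identify true s)) P u1 u2.
Hypothesis hset :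
  ~ jval (fun s i j => identify true s i = identify true s j) P o0 o1.

(** Only finitely many terms are needed to witness [hP]. Their composition
    [star L] is a Taylor term: the choice of a variable in [star L] picks a
    projection for each term in [L], and by [hset] these projections violate
    one of the identities used. *)
Lemma taylor : exists (X : finType) (w : term Sid X),
  forall B : algebra Sid, idem_reduct B -> forall i : X,
  exists I J : pred X, [/\ I i, ~~ J i &
  forall x y : B, eval (fun j => if I j then x else y) w =
                  eval (fun j => if J j then x else y) w].
Proof.
pose sub (L L' : seq (term Sid 'I_3)) := forall t, List.In t L -> List.In t L'.
(* Restricting the relations to the terms of a finite list presents them as directed unions, from
   which one list is extracted. *)
pose e L s t t' :=
  [/\ List.In t L, List.In t' L & mident reducts (identify true s) t t'].
have dir : forall L L', exists2 M, sub L M & sub L' M.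
  move=> L L'; exists (L ++ L') => t h; apply: List.in_or_app; by [left|right].
have me L L' s : sub L L' -> rle (e L s) (e L' s).
  by move=> LL t t' [/LL ? /LL ? ?].
have [L0 hL0] : exists L, jval (e L) P u1 u2.
  apply: (jval_directed dir) => //; move: hP; apply: jval_mono => s t t' tt'.
  by exists [:: t; t']; split=> //=; [left|right; left].
pose L := [:: u1, u2 & L0].
have hL : jval (e L) P u1 u2.
  by move: hL0; apply: jval_mono => s; apply: me => t h; right; right.
have hidx t : exists i : 'I_(size L), List.In t L -> nth u1 L i = t.
  case: (classic (List.In t L)) => [tL|nt]; last by exists ord0.
  suff [k kL kt] : exists2 k, k < size L & nth u1 L k = t.
    by exists (Ordinal kL).
  elim: (L) tL => [[]|a M IH] /= [->|/IH [k kM kt]]; first by exists 0.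
  by exists k.+1.
pose idx t := sval (constructive_indefinite_description _ (hidx t)).
have idxP t : List.In t L -> nth u1 L (idx t) = t.
  by rewrite /idx; case: constructive_indefinite_description.
exists ((size L).-tuple 'I_3), (star L) => B hB K.
have evL t (g : 'I_3 -> B) : List.In t L ->
    eval (fun j => g (tnth j (idx t))) (star L) = eval g t.
  move=> tL; rewrite (eval_star u1) ?idxP // => Y t' x; exact: eval_idem.
have evar u k (g : 'I_3 -> B) : ident reducts u (Var k) -> eval g u = g k.
  by move=> hu; apply: (generated_variety_ident g hB hu).
(* Suppose that no identity is of Taylor type at the place [K]. The coordinates of [K] assign a
   projection [h t] to each term [t] of [L]. *)
pose h t := tnth K (idx t); apply: NNPP => no.
have hvar u k : List.In u L -> ident reducts u (Var k) -> h u = k.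
  move=> uL uk; apply/eqP/negPn/negP => /eqP huk; case: no.
  (* If [u] is the variable [k] but [h u] differs from [k], both sides evaluate to [y], although [K]
     lies in the first set and not in the empty one. *)
  exists (fun j => tnth j (idx u) == h u), pred0; split=> // x y.
  rewrite (evL u (fun k => if k == h u then x else y)) // (evar u k) //=.
  by rewrite eval_idem //; case: eqP => // /esym.
have e1 : h u1 = o0 by apply: hvar hu1; left.
have e2 : h u2 = o1 by apply: hvar hu2; right; left.
apply: hset.
have hm s : maps (fun=> True) h (e L s)
    (fun i j => identify true s i = identify true s j).
  move=> t t' _ [tL t'L tt']; split=> //; apply: NNPP => ne; case: no.
  (* Variables are coloured by whether their identified coordinate is [c]. The identity between [t]
     and [t'] respects the colouring, while the place [K] has different colours on the two sides. *)
  pose c := identify true s (h t).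
  pose I u j := identify true s (tnth j (idx u)) == c.
  exists (I t), (I t'); rewrite /I; split; first exact: eqxx.
    by apply/eqP => /esym.
  move=> x y; pose g (k : 'I_3) := if k == c then x else y.
  rewrite (evL t (fun k => g (identify true s k))) //.
  rewrite (evL t' (fun k => g (identify true s k))) //.
  rewrite -!(eval_rename (identify true s) g).
  exact: (generated_variety_ident g hB tt').
by have [_] := jval_maps hm I hL; rewrite e1 e2.
Qed.

End Taylor.

End Idempotent.

(** * The implications *)

Lemma qcls_mker_inv (S : signature) (K : algebra S -> Prop) (X : Type)
    (hX : inhabited X) sigma t t' :
  mker K hX sigma (qcls (A := term_alg S hX) (ident K (X := X)) t)
                  (qcls (A := term_alg S hX) (ident K (X := X)) t') ->
  mident K sigma t t'.
Proof.
have [[_ tr sy] _] := mident_congruence K hX sigma.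
have hq u : mident K sigma (qrepr (qcls (A := term_alg S hX) (ident K (X := X)) u)) u.
  exact/ident_mident/(qclsK (ident_congruence K hX)).
by move=> h; apply: tr (sy _ _ (hq t)) (tr _ _ _ h (hq t')).
Qed.

Lemma comm_refl (S : signature) (A : algebra S) (a b : relation A) x :
  comm a b x x.
Proof. by have [[[re _ _] _] _ _] := commP a b; apply: re. Qed.

(** Agreement of values at [a] modulo the commutator is a congruence on terms. By idempotence all
    these values lie in one [theta]-class, so its quotient is abelian, and identities of
    [idem_abelian] can be evaluated there. *)
Lemma comm_tr (S : signature) (V : algebra S -> Prop) (A : algebra S)
    (theta : relation A) (a : 'I_3 -> A) sigma (u u' : term (idem_sig V) 'I_3) :
  V A -> congruence theta -> (forall k l, theta (a k) (a l)) ->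
  (forall k, a (sigma k) = a k) -> mident (@idem_abelian S V) sigma u u' ->
  comm theta theta (eval a (tr u)) (eval a (tr u')).
Proof.
move=> hA ct ha as_ uu'.
have [cc zc _] := commP theta theta.
pose d : relation (term_alg (idem_sig V) inh3) :=
  fun s t => comm theta theta (eval a (tr s)) (eval a (tr t)).
have hd : congruence d.
  have [[re tr' sy] co] := cc; split; first split.
  - by move=> t; apply: re.
  - by move=> t1 t2 t3; apply: tr'.
  - by move=> t1 t2; apply: sy.
  - move=> f s t st; rewrite /d /= !eval_subst.
    exact: (eval_congr _ cc).
have Kd : idem_abelian (quot d).
  apply: quot_idem_abelian => // [t t' /ident_tr tt'|].
    by rewrite /d tt' //; apply: comm_refl.
  move=> n m f s t v w _ _.
  pose r (x : 'I_n + 'I_m + term (idem_sig V) 'I_3) : 'I_n + 'I_m + A :=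
    match x with inl z => inl z | inr t => inr (eval a (tr t)) end.
  have E s' v' : eval a (tr (peval (A := term_alg (idem_sig V) inh3) f s' v')) =
      peval (rename r (tr f)) (fun i => eval a (tr (s' i)))
                              (fun j => eval a (tr (v' j))).
    rewrite /peval eval_term_alg eval_rename -!eval_tr eval_subst.
    apply: (@eval_ext _ (idem_reduct_alg V A)) => -[[i|j]|t'] /=;
      by rewrite -eval_tr.
  have th (x y : term (idem_sig V) 'I_3) : theta (eval a (tr x)) (eval a (tr y)).
    have [[_ tr' sy] _] := ct.
    have h (z : term (idem_sig V) 'I_3) : theta (eval a (tr z)) (a o0).
      rewrite -[X in theta _ X](idempotent_tr z (a o0) hA).
      exact: (eval_congr _ ct).
    by apply: tr' (h x) (sy _ _ (h y)).
  by rewrite /d !E; apply: zc.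
pose g : 'I_3 -> quot d := fun k => qcls d (Var k : term_alg _ inh3).
have := mident_eval (g := g) Kd uu'.
rewrite !(eval_generic hd) => h; apply/(qcls_eq hd)/h => k.
by apply/(qcls_eq hd); rewrite /d /= as_; apply: comm_refl.
Qed.

Lemma edgeE (s : 'I_3) (i j : 'I_3) :
  @edge 3 lhs_term s i j <-> i = end1 s /\ j = end2 s.
Proof.
suff : forall s i j, (((val i, val j, s) \in edges lhs_term) =
    (i == end1 s) && (j == end2 s)).
  by move=> h; rewrite /edge h; split=> [/andP[/eqP ? /eqP]|[-> ->]] //; rewrite !eqxx.
by move=> s' i' j'; move: s' i' j'; do 3 apply: I3P.
Qed.

Lemma transversal_identify (s : 'I_3) (sigma : 'I_3 -> 'I_3) b k :
  transversal_of (@edge 3 lhs_term s) sigma -> sigma (identify b s k) = sigma k.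
Proof.
move=> [_ h]; have e : sigma (end1 s) = sigma (end2 s).
  by apply: h; apply: rst_step; apply/edgeE.
rewrite /identify; case: ifP => // /orP[] /eqP ->; by case: b.
Qed.

Lemma identify_transversal (s : 'I_3) b :
  transversal_of (@edge 3 lhs_term s) (identify b s).
Proof.
split=> [x|x y]; last first.
  elim=> {x y} // [x y /edgeE[-> ->]|x y z _ -> _ ->] //; exact: identify_ends.
have e12 : clos_refl_sym_trans _ (@edge 3 lhs_term s) (end1 s) (end2 s).
  by apply: rst_step; apply/edgeE.
rewrite /identify; case: ifP => [|_]; last exact: rst_refl.
by case: b => /orP[] /eqP ->; do ?[exact: rst_refl|exact: e12|exact: rst_sym].
Qed.

Lemma identify_idem b s k : identify b s (identify b s k) = identify b s k.
Proof. exact: (transversal_identify _ _ (identify_transversal s b)). Qed.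

Lemma lhs_identify T (e : 'I_3 -> relation T) x y z b :
  (forall s, equivalence T (e s)) -> e o0 x y -> e o1 x z -> e o2 z y ->
  forall s k, e s (tnth [tuple x; y; z] k) (tnth [tuple x; y; z] (identify b s k)).
Proof.
move=> ee xy xz zy s k; set g := tnth _.
have ge : e s (g (end1 s)) (g (end2 s)) by move: s; apply: I3P.
have [re _ sy] := ee s.
by rewrite /identify; case: ifP => [/orP[] /eqP ->|_] //; case: b => //; apply: sy.
Qed.

Section Main.

Variables (S : signature) (V : algebra S -> Prop) (hV : is_variety V).
Variable p : jterm 3.

Let Kab := @idem_abelian S V.

Lemma idem_abelian_EqC :
  (forall B : algebra (idem_sig V), idem_reduct B -> abelian B ->
   forall e : 'I_3 -> relation B, (forall s, congruence (e s)) ->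
   rle (lhs (e o0) (e o1) (e o2)) (jval e p)) ->
  exists k : nat, 2 < k /\ satisfies_EqC V lhs_term (unjoin k p).
Proof.
move=> h.
pose e s := mker Kab inh3 (identify true s).
have ce s : congruence (e s) by apply: mker_congruence.
have [hB aB] := free_idem_abelian V inh3.
have hj : jval e p (gen Kab inh3 o0) (gen Kab inh3 o1).
  apply: (h _ hB aB e ce); split; first exact: mker_gen.
  by exists (gen Kab inh3 o2); apply: mker_gen.
have re s u : e s u u by have [[re _ _] _] := ce s; apply: re.
have [k0 hk] := jval_unjoin re hj.
exists (maxn 3 k0); split; first exact: leq_maxl.
move=> sigma hsigma.
pose q := unjoin (maxn 3 k0) p.
pose v n := if n is 0 then gen Kab inh3 o0 else gen Kab inh3 o1.
have [|||w wv we] := @cval_graph 3 _ e q 0 1 0 v; try by [].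
  exact/hk/leq_maxr.
(* The two initial vertices must carry the variables themselves, not merely chosen representatives
   of their classes. *)
pose u n : term (idem_sig V) 'I_3 := 
  match n with 0 => Var o0 | 1 => Var o1 | _ => qrepr (w n) end.
have uw n : qcls (A := term_alg _ inh3) (ident Kab (X := 'I_3)) (u n) = w n.
  case: n => [|[|n]]; [by rewrite wv|by rewrite wv|].
  exact: (qreprK (A := term_alg _ inh3)).
exists (fun i => tr (u i)); split=> // s i j ij A hA theta ct a ha.
rewrite !eval_rename; apply: (comm_tr (sigma := identify true s)) => //.
  (* The given transversal is constant on the classes of [identify true s], so one kernel serves all
     transversals. *)
  by move=> k; congr a; apply: transversal_identify.
by apply/(qcls_mker_inv (hX := inh3)); rewrite !uw; apply: we.
Qed.

Lemma EqC_comm k :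
  satisfies_EqC V lhs_term (unjoin k p) ->
  forall A : algebra S, V A ->
  forall alpha beta gamma : relation A,
  congruence alpha -> congruence beta -> congruence gamma ->
  forall Ga Gb Gc : relation A,
  Gchoice alpha beta gamma Ga ->
  Gchoice beta alpha gamma Gb ->
  Gchoice gamma alpha beta Gc ->
  rle (lhs alpha beta gamma)
      (jval3 p (sandwich alpha Ga) (sandwich beta Gb) (sandwich gamma Gc)).
Proof.
move=> hE A hA al be ga ca cb cc Ga Gb Gc hGa hGb hGc x y [xy [z xz zy]].
pose g : 'I_3 -> A := tnth [tuple x; y; z].
pose e : 'I_3 -> relation A := tnth [tuple al; be; ga].
pose G : 'I_3 -> relation A := tnth [tuple Ga; Gb; Gc].
have ce s : congruence (e s) by move: s; apply: I3P.
have [[ra ta sa] _] := ca; have [[rb tb sb] _] := cb.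
have [[rc tc sc] _] := cc; have ea := ca.1; have eb := cb.1; have ec := cc.1.
rewrite /Gchoice /= in hGa hGb hGc.
have mk s b' k1 k2 (theta : relation A) : congruence theta ->
    G s = comm theta theta ->
    (forall k, identify b' s k = k1 \/ identify b' s k = k2) ->
    theta (g k1) (g k2) ->
    exists b theta, [/\ congruence theta, G s = comm theta theta &
      forall k l, theta (g (identify b s k)) (g (identify b s l))].
  move=> ct Gs hk h12; exists b', theta; split=> // k' l'.
  have [[re _ sy] _] := ct.
  by case: (hk k') => ->; case: (hk l') => -> //; apply: sy.
have cm := rmeet_congruence; have cj := rjoin_congruence.
have jn (R Q : relation A) u v w : equivalence A R -> equivalence A Q ->
    R u v -> Q v w -> rjoin R Q u w.
  move=> eR eQ uv vw; apply: (rjoin_trans eR eQ (y := v)); first exact: rjoin_l.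
  exact: rjoin_r.
have [yx zx yz] := And3 (sa _ _ xy) (sb _ _ xz) (sc _ _ zy).
(* Identifying the ends of edge [s] leaves two points, and [b] chooses which end remains. For
   [alpha], keeping [x] leaves [x] and [z], related by [beta] and by the join of [alpha] and
   [gamma]; keeping [y] gives the other choice of [G]. *)
have hG : forall s, exists b theta, [/\ congruence theta, G s = comm theta theta &
    forall k l, theta (g (identify b s k)) (g (identify b s l))].
  apply: I3P.
  - case: hGa => hG; [apply: (mk o0 true o0 o2 _ _ hG)|apply: (mk o0 false o1 o2 _ _ hG)];
      try (by apply: I3P; auto); try (by auto).
    + by split=> //; apply: (jn _ _ _ y).
    + by split=> //; apply: (jn _ _ _ x).
  - case: hGb => hG; [apply: (mk o1 true o0 o1 _ _ hG)|apply: (mk o1 false o2 o1 _ _ hG)];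
      try (by apply: I3P; auto); try (by auto).
    + by split=> //; apply: (jn _ _ _ z).
    + by split=> //; apply: (jn _ _ _ x).
  - case: hGc => hG; [apply: (mk o2 false o1 o0 _ _ hG)|apply: (mk o2 true o2 o0 _ _ hG)];
      try (by apply: I3P; auto); try (by auto).
    + by split=> //; apply: (jn _ _ _ z).
    + by split=> //; apply: (jn _ _ _ y).
pose b s := sval (constructive_indefinite_description _ (hG s)).
have hb s : exists theta, [/\ congruence theta, G s = comm theta theta &
    forall k l, theta (g (identify (b s) s k)) (g (identify (b s) s l))].
  by rewrite /b; case: constructive_indefinite_description.
have [t [t1 t2 te]] := hE (fun s => identify (b s) s)
  (fun s => identify_transversal s (b s)).
pose q := unjoin k p.
pose v n := eval g (t (inord n : 'I_((expand q 0 1 0).1.+2))).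
have vx : v 0 = x.
  by rewrite /v (_ : inord 0 = vert1 q) ?t1 //; apply: val_inj; rewrite /= inordK.
have vy : v 1 = y.
  by rewrite /v (_ : inord 1 = vert2 q) ?t2 //; apply: val_inj; rewrite /= inordK.
rewrite -vx -vy; apply: (@cval_unjoin _ _ _ k).
apply: graph_cval => i j s ijs.
have /andP[/= ib jb] := allP (edges_bound q) _ ijs.
have hs : tnth [tuple sandwich al Ga; sandwich be Gb; sandwich ga Gc] s =
    sandwich (e s) (G s) by move: s {ijs}; apply: I3P.
rewrite hs.
have [theta [ct -> ht]] := hb s.
pose g' k := g (identify (b s) s k).
(* Passing to identified arguments and back supplies the two outer factors of the sandwich; the
   commutator equation supplies the middle one. *)
have gg' n : e s (v n) (eval g' (t (inord n : 'I_((expand q 0 1 0).1.+2)))).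
  apply: (eval_congr _ (ce s)) => l; rewrite /g'.
  by apply: lhs_identify => // s'; have [] := ce s'.
exists (eval g' (t (inord i : 'I_((expand q 0 1 0).1.+2)))) => //.
exists (eval g' (t (inord j : 'I_((expand q 0 1 0).1.+2)))); last first.
  by have [[_ _ sy] _] := ce s; apply: sy.
have ij : @edge 3 q s (inord i) (inord j) by rewrite /edge /= !inordK.
have := te s _ _ ij A hA theta ct g' ht; rewrite !eval_rename.
have g'E : (fun x => g' (identify (b s) s x)) = g'.
  by apply: functional_extensionality => l; rewrite /g' identify_idem.
by rewrite g'E.
Qed.

Definition Pterm_free n i j l : Prop :=
  jval (fun s => mker V inh3 (identify true s)) (Pterm p n i j l)
    (gen V inh3 o0) (gen V inh3 o1).

Lemma lhs_gen (K : algebra S -> Prop) :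
  let e s := mker K inh3 (identify true s) in
  lhs (e o0) (e o1) (e o2) (gen K inh3 o0) (gen K inh3 o1).
Proof. by split; [|exists (gen K inh3 o2)]; apply: mker_gen. Qed.

(** Each herringbone choice bounds the commutator for the same outer congruence; the order of the
    other two only permutes the join. *)
Lemma comm_Frel (A : algebra S) (alpha beta gamma : relation A) i :
  congruence alpha -> congruence beta -> congruence gamma ->
  exists2 G, Gchoice alpha beta gamma G &
    rle G (fun x y => exists n, Frel n alpha beta gamma i x y).
Proof.
move=> ca cb cc; rewrite /Gchoice /=.
have rj (R Q : relation A) : congruence R -> congruence Q -> rjoin R Q = rjoin Q R.
  move=> [eR _] [eQ _]; apply: functional_extensionality => x.
  apply: functional_extensionality => y; apply: propositional_extensionality.
  by split; apply: rjoinC.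
case: i => -[] []; eexists.
- by left; reflexivity.
- exact: comm_herringbone_limit.
- by left; reflexivity.
- by rewrite rj //; exact: comm_herringbone_limit.
- by right; reflexivity.
- exact: comm_herringbone_limit.
- by right; reflexivity.
- by rewrite rj //; exact: comm_herringbone_limit.
Qed.

Lemma comm_herringbone :
  (forall A : algebra S, V A ->
    forall alpha beta gamma : relation A,
    congruence alpha -> congruence beta -> congruence gamma ->
    forall Ga Gb Gc : relation A,
    Gchoice alpha beta gamma Ga ->
    Gchoice beta alpha gamma Gb ->
    Gchoice gamma alpha beta Gc ->
    rle (lhs alpha beta gamma)
        (jval3 p (sandwich alpha Ga) (sandwich beta Gb) (sandwich gamma Gc))) ->
  exists n : nat, forall i j l,
    forall A : algebra S, V A ->
    forall e : 'I_3 -> relation A, (forall s, congruence (e s)) ->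
    rle (lhs (e o0) (e o1) (e o2)) (jval e (Pterm p n i j l)).
Proof.
move=> h3.
pose e0 s := mker V inh3 (identify true s).
have ce0 s : congruence (e0 s) by apply: mker_congruence.
(* The choices for [gamma] list [alpha] and [beta] in opposite orders in (3) and (4); the set of
   choices of [G] is symmetric in them. *)
have gCb (A : algebra S) (a b c R : relation A) : Gchoice a b c R -> Gchoice a c b R.
  by rewrite /Gchoice /=; case=> ->; [right|left].
have one (ijl : (bool * bool) * (bool * bool) * (bool * bool)) :
    exists n, Pterm_free n ijl.1.1 ijl.1.2 ijl.2.
  case: ijl => -[i j] l /=.
  have [Ga hGa leA] := comm_Frel i (ce0 o0) (ce0 o1) (ce0 o2).
  have [Gb hGb leB] := comm_Frel j (ce0 o1) (ce0 o0) (ce0 o2).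
  have [Gc hGc leC] := comm_Frel l (ce0 o2) (ce0 o1) (ce0 o0).
  have hFV := free_variety inh3 hV.
  have := h3 _ hFV _ _ _ (ce0 o0) (ce0 o1) (ce0 o2) _ _ _ hGa hGb (gCb _ _ _ _ _ hGc)
    _ _ (lhs_gen V).
  have sand (s : 'I_3) (G : relation (free V inh3)) (F : nat -> relation (free V inh3)) :
      rle G (fun x y => exists n, F n x y) ->
      rle (sandwich (e0 s) G) (fun x y => exists n, sandwich (e0 s) (F n) x y).
    move=> GF x y [z xz [w /GF [n zw] wy]]; exists n, z => //.
    by exists w.
  move=> hj; have {}hj : jval (fun s x y => exists n, Fsand n e0 i j l s x y) p
      (gen V inh3 o0) (gen V inh3 o1).
    by move: hj; apply: jval_mono; apply: I3P; apply: sand.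
  have me n m s : n <= m -> rle (Fsand n e0 i j l s) (Fsand m e0 i j l s).
    move=> nm; move: s; apply: I3P; move=> x y [z xz [w zw wy]];
      by exists z => //; exists w => //; apply: Frel_leq zw.
  have [n hn] := jval_directed leq_directed me hj.
  by exists n; rewrite /Pterm_free jval_Pterm.
pose nn ijl := sval (constructive_indefinite_description _ (one ijl)).
(* There are finitely many triples of choices, and the right hand sides increase with [n]. *)
exists (\max_ijl nn ijl) => i j l A hA e ce x y [xy [z xz zy]].
have hF : Pterm_free (\max_ijl nn ijl) i j l.
  apply: (Pterm_leq (n := nn (i, j, l))); first exact: leq_bigmax.
  by rewrite /nn; case: constructive_indefinite_description.
pose g : 'I_3 -> A := tnth [tuple x; y; z].
have ge s k : e s (g k) (g (identify true s k)).
  by apply: lhs_identify => // s'; have [] := ce s'.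
have mp s : maps (fun=> True) (fun q : free V inh3 => eval g (qrepr q))
    (mker V inh3 (identify true s)) (e s).
  by apply: mker_maps.
have [_] := jval_maps mp I hF.
by rewrite !eval_qrepr.
Qed.

(** The least relations on the three vertices that contain the respective edges: each has one class
    of two elements. *)
Let std (s : 'I_3) : relation 'I_3 :=
  fun i j => identify true s i = identify true s j.

Lemma idem_abelian_herringbone n i j l :
  ~ jval std p o0 o1 ->
  (forall A : algebra S, V A ->
    forall e : 'I_3 -> relation A, (forall s, congruence (e s)) ->
    rle (lhs (e o0) (e o1) (e o2)) (jval e (Pterm p n i j l))) ->
  forall B : algebra (idem_sig V), idem_reduct B -> abelian B ->
  forall e : 'I_3 -> relation B, (forall s, congruence (e s)) ->
  rle (lhs (e o0) (e o1) (e o2)) (jval e p).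
Proof.
move=> hset h4; set P := Pterm p n i j l in h4.
pose id_ := identify true.
have hF : jval (fun s => mker V inh3 (id_ s)) P (gen V inh3 o0) (gen V inh3 o1).
  apply: (h4 _ (free_variety inh3 hV) (fun s => mker V inh3 (id_ s))).
    by move=> s; apply: mker_congruence.
  exact: lhs_gen.
pose N (q : free V inh3) := idempotent_in V (qrepr q : term S 'I_3).
(* An idempotent representative is itself a basic operation of the reduct; [Var o0] is a default
   outside [N]. *)
have hex (q : free V inh3) : exists u : term (idem_sig V) 'I_3,
    N q -> ident V (tr u) (qrepr q : term S 'I_3).
  case: (classic (N q)) => [Nq|nN]; last by exists (Var o0).
  pose f : op (idem_sig V) := existT _ 3 (exist (@idempotent_in S V 3) (qrepr q) Nq).
  exists (@App (idem_sig V) 'I_3 f (fun k => Var k)).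
  by move=> _ A _ g /=; rewrite eval_subst.
pose h q := sval (constructive_indefinite_description _ (hex q)).
have hP q : N q -> ident V (tr (h q)) (qrepr q : term S 'I_3).
  by rewrite /h; case: constructive_indefinite_description.
(* Idempotence passes along the kernels, since identified variables make no difference when all
   variables are equal. *)
have hm s : maps N h (mker V inh3 (id_ s)) (mident (@reducts S V) (id_ s)).
  move=> x y Nx xy; have Ny : N y.
    move=> A hA a; rewrite -[RHS](Nx A hA a).
    by apply/esym/(mident_eval hA xy).
  split=> //; apply/mident_tr => A hA g.
  have := xy A hA g; rewrite !eval_rename => xyg.
  by rewrite (hP _ Nx) // (hP _ Ny).
have Ng k : N (gen V inh3 k) by move=> A hA a; rewrite eval_qrepr.
have hg k : ident (@reducts S V) (h (gen V inh3 k)) (Var k).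
  by apply/ident_tr => A hA g; rewrite (hP _ (Ng k)) // eval_qrepr.
have [_ hj] := jval_maps hm (Ng o0) hF.
have eqv_std s : equivalence _ (std s).
  by rewrite /std; split=> [x|x y z -> ->|x y ->].
have std_trivial : [/\ trivial_meet (std o0) (std o1),
    trivial_meet (std o0) (std o2) & trivial_meet (std o1) (std o2)].
  by split; do 2 apply: I3P; move=> [/(congr1 val) /= h1 /(congr1 val) /= h2].
have hsetP : ~ jval std P o0 o1.
  have [s01 s02 s12] := std_trivial.
  by move=> /(Pterm_trivial eqv_std s01 s02 s12).
have [X [w tw]] := taylor (hg o0) (hg o1) hj hsetP.
pose e3 s := mker Kab inh3 (id_ s).
(* Here [s] merges [c] with [d], and [s'] merges the two variables other than [c]. With [c] as one
   block and constant value [g d] for [a'] and [b'], [s'] gives the corner with [a] and [b'], and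
   [s] gives the other two known corners. *)
have triv s s' c d :
    (forall (T : Type) (g : 'I_3 -> T) k,
       (if id_ s' k == c then g (id_ s' k) else g d) = if k == c then g k else g d) ->
    (forall (T : Type) (g : 'I_3 -> T) k,
       (if id_ s k == c then g d else g (id_ s k)) = if k == c then g d else g k) ->
    trivial_meet (e3 s) (e3 s').
  move=> hs' hs x y [xy xy'].
  have := qreprK (A := term_alg (idem_sig V) inh3) (d := ident Kab (X := 'I_3)).
  move=> hK; rewrite -(hK x) -(hK y); apply/(qcls_eq (ident_congruence Kab inh3)).
  move=> B KB g; have [rB aB] := KB.
  have eD (t : term (idem_sig V) 'I_3) :
      eval g t = eval (fun k => if k == c then g k else g k) t.
    by apply: eval_ext => k; case: ifP.
  rewrite !eD; apply: (two_term (w := w) (D := pred1 c) aB _ (tw _ rB)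
    (a' := fun=> g d) (b' := fun=> g d)).
  - by move=> a; apply: eval_idem.
  - by apply: (mident_eval KB xy') => k; apply: hs'.
  - by apply: (mident_eval KB xy) => k; apply: hs.
  - by apply: (mident_eval KB xy) => k; case: ifP; case: ifP.
have h3 : jval e3 p (gen Kab inh3 o0) (gen Kab inh3 o1).
  apply: (@Pterm_trivial _ e3 p n i j l).
  - by move=> s; have [] := mker_congruence Kab inh3 (id_ s).
  - by apply: (triv _ _ o1 o0) => T g; apply: I3P.
  - by apply: (triv _ _ o0 o1) => T g; apply: I3P.
  - by apply: (triv _ _ o0 o2) => T g; apply: I3P.
  pose cl := qcls (A := term_alg (idem_sig V) inh3) (ident Kab (X := 'I_3)).
  have mq s : maps (fun=> True) cl (mident (@reducts S V) (id_ s)) (e3 s).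
    by move=> t t' _ tt'; split=> //; apply: qcls_mker; apply: ident_idem_abelian.
  have clg k : cl (h (gen V inh3 k)) = gen Kab inh3 k.
    by apply/(qcls_eq (ident_congruence Kab inh3))/ident_idem_abelian/hg.
  by rewrite -!clg; have [] := jval_maps mq I hj.
move=> B hB aB e ce x y [xy [z xz zy]].
pose g : 'I_3 -> B := tnth [tuple x; y; z].
have ge s k : e s (g k) (g (id_ s k)).
  by apply: lhs_identify => // s'; have [] := ce s'.
have KB : Kab B by [].
have mp s : maps (fun=> True) (fun q : free Kab inh3 => eval g (qrepr q))
    (e3 s) (e s).
  by apply: mker_maps.
have [_] := jval_maps mp I h3.
by rewrite !eval_qrepr.
Qed.

End Main.

Theorem theorem5p3 (S : signature) (V : algebra S -> Prop) (hV : is_variety V)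
  (p : jterm 3)
  (hp : exists alpha0 beta0 gamma0 : relation 'I_3,
      [/\ equivalence 'I_3 alpha0,
          equivalence 'I_3 beta0 &
          equivalence 'I_3 gamma0] /\
      [/\ forall x y, rmeet alpha0 beta0 x y <-> x = y,
          forall x y, rmeet alpha0 gamma0 x y <-> x = y &
          forall x y, rmeet beta0 gamma0 x y <-> x = y] /\
      ~ rle (lhs alpha0 beta0 gamma0) (jval3 p alpha0 beta0 gamma0)) :
  let cond1 :=
    forall B : algebra (idem_sig V), idem_reduct B -> abelian B ->
    forall alpha beta gamma : relation B,
    congruence alpha -> congruence beta -> congruence gamma ->
    rle (lhs alpha beta gamma) (jval3 p alpha beta gamma) in
  let cond2 :=
    exists k : nat, 2 < k /\ satisfies_EqC V lhs_term (unjoin k p) in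
  let cond3 :=
    forall A : algebra S, V A ->
    forall alpha beta gamma : relation A,
    congruence alpha -> congruence beta -> congruence gamma ->
    forall Ga Gb Gc : relation A,
    Gchoice alpha beta gamma Ga ->
    Gchoice beta alpha gamma Gb ->
    Gchoice gamma alpha beta Gc ->
    rle (lhs alpha beta gamma)
        (jval3 p (sandwich alpha Ga) (sandwich beta Gb) (sandwich gamma Gc)) in
  let cond4 :=
    exists n : nat,
    forall A : algebra S, V A ->
    forall alpha beta gamma : relation A,
    congruence alpha -> congruence beta -> congruence gamma ->
    forall Fa Fb Fc : relation A,
    Fchoice n alpha beta gamma Fa ->
    Fchoice n beta alpha gamma Fb ->
    Fchoice n gamma beta alpha Fc ->
    rle (lhs alpha beta gamma)
        (jval3 p (sandwich alpha Fa) (sandwich beta Fb) (sandwich gamma Fc)) in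
  (cond1 <-> cond2) /\ (cond1 <-> cond3) /\ (cond1 <-> cond4).

Proof.
move=> cond1 cond2 cond3 cond4.
pose std (s i j : 'I_3) := identify true s i = identify true s j.
(* At a pair where the given equation fails, sending the vertices to [x], [y], [z] maps each [std s]
   into the given relation, so [std] fails as well. *)
have hset : ~ jval std p o0 o1.
  move=> hs; case: hp => al [be [ga [[ea eb ec] [_ hn]]]].
  apply: hn => x y [xy [z xz zy]].
  pose e : 'I_3 -> relation 'I_3 := tnth [tuple al; be; ga].
  have ee s : equivalence _ (e s) by move: s; apply: I3P.
  have ge := @lhs_identify _ e x y z true ee xy xz zy.
  have mp s : maps (fun=> True) (tnth [tuple x; y; z]) (std s) (e s).
    move=> i j _ ij; split=> //; have [_ tr sy] := ee s.
    by apply: tr (ge s i) _; rewrite ij; apply: sy.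
  by have [] := jval_maps mp I hs.
have c12 : cond1 -> cond2.
  move=> h; apply: idem_abelian_EqC => B hB aB e ce.
  by rewrite -jval3E; apply: h.
have c23 : cond2 -> cond3 by move=> [k [_ hk]]; apply: EqC_comm hk.
have c34 : cond3 -> cond4.
  move=> /(comm_herringbone hV) [n hn]; exists n => A hA al be ga ca cb cc.
  move=> Fa Fb Fc /Fchoice_Frel[i ->] /Fchoice_Frel[j ->] /Fchoice_Frel[l ->].
  have := hn i j l A hA (tnth [tuple al; be; ga]); rewrite jval_Pterm.
  by apply; apply: I3P.
have c41 : cond4 -> cond1.
  move=> [n hn] B hB aB al be ga ca cb cc.
  pose tt2 := (true, true).
  apply: (@idem_abelian_herringbone _ _ hV p n tt2 tt2 tt2 hset _ B hB aB
    (tnth [tuple al; be; ga])); last by apply: I3P.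
  move=> A hA e ce; rewrite jval_Pterm.
  by apply: hn => //; apply/Fchoice_Frel; exists tt2.
by split; [|split]; split; auto.
Qed.
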